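(* Let $k$ be an arbitrary field. Then $$ \sum_{x \in (\mathbb P^1_k)_{(0)}} \mathrm{Tr}^\omega_{\kappa_x/k*} \circ \partial_x=0 $$ as maps $\mathrm K^{MW}_1\big(k(t),\omega_{k(t)/k}\big)\to\mathrm{GW}(k)$, where the sum is over all closed points $x$ of $\mathbb P^1_k$ and $\partial_x:\mathrm K^{MW}_1\big(k(t),\omega_{k(t)/k}\big)\to\mathrm{GW}(\kappa_x,\omega_{\kappa_x/k})$ is the residue map associated with the discrete valuation on $k(t)$ defined by $x$.
   Context: Milnor-Witt K-theory. For a field $K$, $\mathrm K^{MW}_*(K)$ is the $\mathbb Z$-graded associative ring generated by $[a]$ ($a\in K^\times$) in degree $1$ and $\eta$ in degree $-1$, with relations $[a][1-a]=0$ ($a\neq0,1$), $[ab]=[a]+[b]+\eta[a][b]$, $\eta[a]=[a]\eta$, $\eta(2+\eta[-1])=0$. Put $\langle a\rangle=1+\eta[a]$, $\epsilon=-\langle-1\rangle$, $n_\epsilon=\sum_{i=0}^{n-1}(-\epsilon)^i$ ($n\ge0$), $n_\epsilon=\epsilon(-n)_\epsilon$ ($n<0$). For a one-dimensional $K$-vector space $L$, $\mathrm K^{MW}_n(K,L)=\mathrm K^{MW}_n(K)\otimes_{\mathbb Z[K^\times]}\mathbb Z[L\setminus\{0\}]$, $u\in K^\times$ acting on the left factor by $\langle u\rangle$. In degree $0$ this is $\mathrm{GW}(K,L)$, the Grothendieck group of $L$-valued non-degenerate symmetric bilinear forms ($\langle u\rangle\otimes l$ corresponding to $(x,y)\mapsto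 uxy\,l$). Residues. For a discretely valued field $(K,v)$ with residue field $\kappa_v$ and $\omega_v=(\mathcal M_v/\mathcal M_v^2)^\vee$, $\partial_v:\mathrm K^{MW}_n(K)\to\mathrm K^{MW}_{n-1}(\kappa_v,\omega_v)$ is the unique $\eta$-linear map with $\partial_v([v_1\pi^m][u_2]\cdots[u_n])=m_\epsilon\langle\overline{v_1}\rangle[\overline{u_2}]\cdots[\overline{u_n}]\otimes\bar\pi^*$ for any uniformizer $\pi$ and units $v_1,u_i$ of $\mathcal O_v$. For an invertible $\mathcal O_v$-module with generator $l_0$, $\partial_v(\sigma\otimes l_0)=\partial_v(\sigma)\otimes\overline{l_0}$. Twists on $\mathbb P^1_k$. Let $\omega$ be the canonical sheaf of $\mathbb P^1_k$ over $k$; its generic fiber is $\omega_{k(t)/k}=\Omega_{k(t)/k}$. For a closed point $x$ with residue field $\kappa_x$, let $\omega_{\kappa_x/k}$ be the determinant of the cotangent complex of $\kappa_x/k$. The residue of the $\omega$-twisted theory lands in twist $\omega_{x/\mathbb P^1_k}\otimes\omega|_x$, where $\omega_{x/\mathbb P^1_k}=(\mathcal M_x/\mathcal M_x^2)^\vee$, which is canonically identified with $\omega_{\kappa_x/k}$. Concretely, if $x\in\mathbb A^1_k$ corresponds to the monic irreducible polynomial $\pi_x$ and $I=(\pi_x)\subset k[t]$, then $\omega_{\kappa_x/k}=(I/I^2)^\vee\otimes\Omega_{k[t]/k}$ has basis $\bar\pi_x^*\otimes dt$; for $x=\infty$ and $s=1/t$, $\omega_{\kappa_\infty/k}=k$ with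 $\bar s^*\otimes ds\mapsto 1$. Transfers. For a finite extension $E/k$, $\mathrm{Tr}^\omega_{E/k}:\omega_{E/k}\to k$ is the trace map of Grothendieck duality (induced by $\omega_{E/k}\simeq f^!k$ and the counit $f_*f^!k\to k$, $f:\mathrm{Spec}\,E\to\mathrm{Spec}\,k$). If $E=k[\alpha]=k[t]/(f)$ with $f$ monic of degree $d$, it is given by $\mathrm{Tr}^\omega_{E/k}(b\cdot\bar f^*\otimes dt)=\tau(b)$, where $\tau$ is the $k$-linear form with $\tau(\alpha^{d-1})=1$, $\tau(\alpha^i)=0$ for $0\le i<d-1$. The transfer $\mathrm{Tr}^\omega_{E/k*}:\mathrm{GW}(E,\omega_{E/k})\to\mathrm{GW}(k)$ sends the class of an $\omega_{E/k}$-valued inner product $\Phi:V\otimes_EV\to\omega_{E/k}$ to the class of $\mathrm{Tr}^\omega_{E/k}\circ\Phi:V\otimes_kV\to k$. *)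

(* Defs.v *)
From HB Require Import structures.
From mathcomp Require Import all_boot all_order all_algebra all_field.
From mathcomp Require Import boolp.

Set Implicit Arguments.
Unset Strict Implicit.
Unset Printing Implicit Defensive.

Import Order.TTheory GRing.Theory Num.Theory VectorInternalTheory.
Local Open Scope ring_scope.
Local Open Scope quotient_scope.

(* Abelian groups presented by generators X and relations R *)
Inductive aterm (X : Type) : Type :=
| AGen of X
| AZero
| AOpp of aterm X
| AAdd of aterm X & aterm X.
Arguments AZero {X}.

Section PresentedGroup.
Variables (X : Type) (R : aterm X -> aterm X -> Prop).

Inductive acong : aterm X -> aterm X -> Prop :=
| acong_rel s t : R s t -> acong s t
| acong_refl s : acong s s
| acong_sym s t : acong s t -> acong t s
| acong_trans t s u : acong s t -> acong t u -> acong s u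
| acong_opp s t : acong s t -> acong (AOpp s) (AOpp t)
| acong_add s s' t t' : acong s s' -> acong t t' ->
    acong (AAdd s t) (AAdd s' t')
| acong_addA s t u : acong (AAdd s (AAdd t u)) (AAdd (AAdd s t) u)
| acong_addC s t : acong (AAdd s t) (AAdd t s)
| acong_add0 s : acong (AAdd AZero s) s
| acong_addN s : acong (AAdd (AOpp s) s) AZero.

Definition acongb s t := `[< acong s t >].

Fact acongb_refl : reflexive acongb.
Proof. by move=> s; apply/asboolP; exact: acong_refl. Qed.
Fact acongb_sym : symmetric acongb.
Proof.
by move=> s t; apply/asboolP/asboolP; exact: acong_sym.
Qed.
Fact acongb_trans : transitive acongb.
Proof.
move=> t s u /asboolP st /asboolP tu; apply/asboolP.
exact: acong_trans st tu.
Qed.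

HB.instance Definition _ := gen_eqMixin (aterm X).
HB.instance Definition _ := gen_choiceMixin (aterm X).

Canonical acong_equiv := EquivRel acongb acongb_refl acongb_sym acongb_trans.

Definition pgrp := {eq_quot acongb}.
HB.instance Definition _ := Choice.on pgrp.
HB.instance Definition _ := EqQuotient.on pgrp.

Definition pcls (s : aterm X) : pgrp := \pi_pgrp s.
Definition pgen (x : X) : pgrp := pcls (AGen x).

Lemma pcls_eq s t : pcls s = pcls t <-> acong s t.
Proof. by split=> [/eqmodP /asboolP|st] //; apply/eqmodP/asboolP. Qed.

Lemma repr_pcls s : acong (repr (pcls s)) s.
Proof. by apply/pcls_eq; rewrite /pcls reprK. Qed.

Lemma pcls_repr (a : pgrp) : pcls (repr a) = a.
Proof. by rewrite /pcls reprK. Qed.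

Definition padd (a b : pgrp) : pgrp := pcls (AAdd (repr a) (repr b)).
Definition popp (a : pgrp) : pgrp := pcls (AOpp (repr a)).

Lemma paddE s t : padd (pcls s) (pcls t) = pcls (AAdd s t).
Proof. by apply/pcls_eq/acong_add; exact: repr_pcls. Qed.
Lemma poppE s : popp (pcls s) = pcls (AOpp s).
Proof. by apply/pcls_eq/acong_opp; exact: repr_pcls. Qed.

Fact paddA : associative padd.
Proof.
move=> a b c; rewrite -(pcls_repr a) -(pcls_repr b) -(pcls_repr c) !paddE.
exact/pcls_eq/acong_addA.
Qed.
Fact paddC : commutative padd.
Proof.
move=> a b; rewrite -(pcls_repr a) -(pcls_repr b) !paddE.
exact/pcls_eq/acong_addC.
Qed.
Fact padd0 : left_id (pcls AZero) padd.
Proof.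
by move=> a; rewrite -(pcls_repr a) paddE; apply/pcls_eq/acong_add0.
Qed.
Fact paddN : left_inverse (pcls AZero) popp padd.
Proof.
move=> a; rewrite -(pcls_repr a) poppE paddE.
exact/pcls_eq/acong_addN.
Qed.

HB.instance Definition _ :=
  GRing.isZmodule.Build pgrp paddA paddC padd0 paddN.

Variables (G : zmodType) (f : X -> G).

Fixpoint aeval (s : aterm X) : G :=
  match s with
  | AGen x => f x
  | AZero => 0
  | AOpp s => - aeval s
  | AAdd s t => aeval s + aeval t
  end.

Hypothesis f_rel : forall s t, R s t -> aeval s = aeval t.

Lemma aeval_cong s t : acong s t -> aeval s = aeval t.
Proof.
elim=> //=.
- by move=> t0 s0 u _ -> _ ->.
- by move=> s0 t0 _ ->.
- by move=> s0 s' t0 t' _ -> _ ->.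
- by move=> s0 t0 u; rewrite addrA.
- by move=> s0 t0; rewrite addrC.
- by move=> s0; rewrite add0r.
- by move=> s0; rewrite addNr.
Qed.

Definition plift of (forall s t, R s t -> aeval s = aeval t) :=
  fun a : pgrp => aeval (repr a).

Lemma plift_cls s : plift f_rel (pcls s) = aeval s.
Proof. exact/aeval_cong/repr_pcls. Qed.

Lemma plift_gen x : plift f_rel (pgen x) = f x.
Proof. exact: plift_cls. Qed.

Fact plift_is_zmod_morphism : zmod_morphism (plift f_rel).
Proof.
move=> a b; rewrite -(pcls_repr a) -(pcls_repr b).
have -> : pcls (repr a) - pcls (repr b)
        = pcls (AAdd (repr a) (AOpp (repr b))).
  by rewrite -[LHS]/(padd _ (popp _)) poppE paddE.
by rewrite !plift_cls.
Qed.

HB.instance Definition _ :=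
  GRing.isZmodMorphism.Build pgrp G (plift f_rel) plift_is_zmod_morphism.

End PresentedGroup.

Section MilnorWitt.
Variable K : fieldType.

(* A generator [a] is allowed for every a : K, and the superfluous one [0] is
   set to zero by kmw_sym0. *)
Inductive kmw_term : Type :=
| TSym of K
| TEta
| TZero
| TOne
| TOpp of kmw_term
| TAdd of kmw_term & kmw_term
| TMul of kmw_term & kmw_term.

Inductive kmw_cong : kmw_term -> kmw_term -> Prop :=
| kmw_steinberg a : a != 0 -> a != 1 ->
    kmw_cong (TMul (TSym a) (TSym (1 - a))) TZero
| kmw_symM a b : a != 0 -> b != 0 ->
    kmw_cong (TSym (a * b))
      (TAdd (TAdd (TSym a) (TSym b)) (TMul TEta (TMul (TSym a) (TSym b))))
| kmw_etaC a : kmw_cong (TMul TEta (TSym a)) (TMul (TSym a) TEta)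
| kmw_hyp :
    kmw_cong (TMul TEta (TAdd (TAdd TOne TOne) (TMul TEta (TSym (- 1))))) TZero
| kmw_sym0 : kmw_cong (TSym 0) TZero
| kmw_refl s : kmw_cong s s
| kmw_sym s t : kmw_cong s t -> kmw_cong t s
| kmw_trans t s u : kmw_cong s t -> kmw_cong t u -> kmw_cong s u
| kmw_opp s t : kmw_cong s t -> kmw_cong (TOpp s) (TOpp t)
| kmw_add s s' t t' : kmw_cong s s' -> kmw_cong t t' ->
    kmw_cong (TAdd s t) (TAdd s' t')
| kmw_mul s s' t t' : kmw_cong s s' -> kmw_cong t t' ->
    kmw_cong (TMul s t) (TMul s' t')
| kmw_addA s t u : kmw_cong (TAdd s (TAdd t u)) (TAdd (TAdd s t) u)
| kmw_addC s t : kmw_cong (TAdd s t) (TAdd t s)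
| kmw_add0 s : kmw_cong (TAdd TZero s) s
| kmw_addN s : kmw_cong (TAdd (TOpp s) s) TZero
| kmw_mulA s t u : kmw_cong (TMul s (TMul t u)) (TMul (TMul s t) u)
| kmw_mul1l s : kmw_cong (TMul TOne s) s
| kmw_mul1r s : kmw_cong (TMul s TOne) s
| kmw_mulDl s t u :
    kmw_cong (TMul (TAdd s t) u) (TAdd (TMul s u) (TMul t u))
| kmw_mulDr s t u :
    kmw_cong (TMul s (TAdd t u)) (TAdd (TMul s t) (TMul s u)).

Inductive kmw_homog : int -> kmw_term -> Prop :=
| homog_sym a : kmw_homog 1 (TSym a)
| homog_eta : kmw_homog (- 1) TEta
| homog_zero n : kmw_homog n TZero
| homog_one : kmw_homog 0 TOne
| homog_opp n s : kmw_homog n s -> kmw_homog n (TOpp s)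
| homog_add n s t : kmw_homog n s -> kmw_homog n t -> kmw_homog n (TAdd s t)
| homog_mul m n s t : kmw_homog m s -> kmw_homog n t ->
    kmw_homog (m + n) (TMul s t).

Definition kmw_congb s t := `[< kmw_cong s t >].

Fact kmw_congb_refl : reflexive kmw_congb.
Proof. by move=> s; apply/asboolP; exact: kmw_refl. Qed.
Fact kmw_congb_sym : symmetric kmw_congb.
Proof. by move=> s t; apply/asboolP/asboolP; exact: kmw_sym. Qed.
Fact kmw_congb_trans : transitive kmw_congb.
Proof.
move=> t s u /asboolP st /asboolP tu; apply/asboolP.
exact: kmw_trans st tu.
Qed.

HB.instance Definition _ := gen_eqMixin kmw_term.
HB.instance Definition _ := gen_choiceMixin kmw_term.

Canonical kmw_equiv :=
  EquivRel kmw_congb kmw_congb_refl kmw_congb_sym kmw_congb_trans.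

Definition KMWring := {eq_quot kmw_congb}.
HB.instance Definition _ := Choice.on KMWring.
HB.instance Definition _ := EqQuotient.on KMWring.

Definition kcls (s : kmw_term) : KMWring := \pi_KMWring s.

Lemma kcls_eq s t : kcls s = kcls t <-> kmw_cong s t.
Proof. by split=> [/eqmodP /asboolP|st] //; apply/eqmodP/asboolP. Qed.

Lemma repr_kcls s : kmw_cong (repr (kcls s)) s.
Proof. by apply/kcls_eq; rewrite /kcls reprK. Qed.

Lemma kcls_repr (a : KMWring) : kcls (repr a) = a.
Proof. by rewrite /kcls reprK. Qed.

Definition kadd (a b : KMWring) : KMWring := kcls (TAdd (repr a) (repr b)).
Definition kopp (a : KMWring) : KMWring := kcls (TOpp (repr a)).
Definition kmul (a b : KMWring) : KMWring := kcls (TMul (repr a) (repr b)).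

Lemma kaddE s t : kadd (kcls s) (kcls t) = kcls (TAdd s t).
Proof. by apply/kcls_eq/kmw_add; exact: repr_kcls. Qed.
Lemma koppE s : kopp (kcls s) = kcls (TOpp s).
Proof. by apply/kcls_eq/kmw_opp; exact: repr_kcls. Qed.
Lemma kmulE s t : kmul (kcls s) (kcls t) = kcls (TMul s t).
Proof. by apply/kcls_eq/kmw_mul; exact: repr_kcls. Qed.

Fact kaddA : associative kadd.
Proof.
move=> a b c; rewrite -(kcls_repr a) -(kcls_repr b) -(kcls_repr c) !kaddE.
exact/kcls_eq/kmw_addA.
Qed.
Fact kaddC : commutative kadd.
Proof.
move=> a b; rewrite -(kcls_repr a) -(kcls_repr b) !kaddE.
exact/kcls_eq/kmw_addC.
Qed.
Fact kadd0 : left_id (kcls TZero) kadd.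
Proof.
by move=> a; rewrite -(kcls_repr a) kaddE; apply/kcls_eq/kmw_add0.
Qed.
Fact kaddN : left_inverse (kcls TZero) kopp kadd.
Proof.
move=> a; rewrite -(kcls_repr a) koppE kaddE.
exact/kcls_eq/kmw_addN.
Qed.

HB.instance Definition _ :=
  GRing.isZmodule.Build KMWring kaddA kaddC kadd0 kaddN.

Fact kmulA : associative kmul.
Proof.
move=> a b c; rewrite -(kcls_repr a) -(kcls_repr b) -(kcls_repr c) !kmulE.
exact/kcls_eq/kmw_mulA.
Qed.
Fact kmul1l : left_id (kcls TOne) kmul.
Proof.
by move=> a; rewrite -(kcls_repr a) kmulE; apply/kcls_eq/kmw_mul1l.
Qed.
Fact kmul1r : right_id (kcls TOne) kmul.
Proof.
by move=> a; rewrite -(kcls_repr a) kmulE; apply/kcls_eq/kmw_mul1r.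
Qed.
Fact kmulDl : left_distributive kmul kadd.
Proof.
move=> a b c; rewrite -(kcls_repr a) -(kcls_repr b) -(kcls_repr c).
rewrite !(kaddE, kmulE); exact/kcls_eq/kmw_mulDl.
Qed.
Fact kmulDr : right_distributive kmul kadd.
Proof.
move=> a b c; rewrite -(kcls_repr a) -(kcls_repr b) -(kcls_repr c).
rewrite !(kaddE, kmulE); exact/kcls_eq/kmw_mulDr.
Qed.

HB.instance Definition _ :=
  GRing.Zmodule_isPzRing.Build KMWring kmulA kmul1l kmul1r kmulDl kmulDr.

Definition sym (a : K) : KMWring := kcls (TSym a).
Definition eta : KMWring := kcls TEta.
Definition ang (a : K) : KMWring := 1 + eta * sym a.
Definition eps : KMWring := - ang (- 1).

Definition neps (n : int) : KMWring :=
  match n with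
  | Posz m => \sum_(i < m) (- eps) ^+ i
  | Negz m => eps * \sum_(i < m.+1) (- eps) ^+ i
  end.

(* The relations are homogeneous, so the elements represented by a term of
   degree n form the degree n part of the graded ring. *)
Definition kmw_deg (n : int) : {pred KMWring} :=
  fun x => `[< exists2 s, kmw_homog n s & x = kcls s >].

Lemma kmw_degP n x :
  reflect (exists2 s, kmw_homog n s & x = kcls s) (x \in kmw_deg n).
Proof. exact: asboolP. Qed.

Fact kmw_deg_zmod_closed n : zmod_closed (kmw_deg n).
Proof.
split; first by apply/kmw_degP; exists TZero => //; exact: homog_zero.
move=> x y /kmw_degP[s hs ->] /kmw_degP[t ht ->]; apply/kmw_degP.
exists (TAdd s (TOpp t)); first exact/homog_add/homog_opp.
by rewrite -[LHS]/(kadd _ (kopp _)) koppE kaddE.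
Qed.

HB.instance Definition _ n :=
  GRing.isZmodClosed.Build KMWring (kmw_deg n) (kmw_deg_zmod_closed n).

Record KMW (n : int) : predArgType :=
  MkKMW { kmw_val :> KMWring; _ : kmw_val \in kmw_deg n }.

HB.instance Definition _ n := [isSub for @kmw_val n].
HB.instance Definition _ n := [Choice of KMW n by <:].
HB.instance Definition _ n := [SubChoice_isSubZmodule of KMW n by <:].

Lemma kmw_degM m n x y :
  x \in kmw_deg m -> y \in kmw_deg n -> x * y \in kmw_deg (m + n).
Proof.
move=> /kmw_degP[s hs ->] /kmw_degP[t ht ->]; apply/kmw_degP.
by exists (TMul s t); [exact: homog_mul | rewrite -kmulE].
Qed.

Lemma kmw_deg_sym a : sym a \in kmw_deg 1.
Proof. by apply/kmw_degP; exists (TSym a) => //; exact: homog_sym. Qed.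

Lemma kmw_deg_eta : eta \in kmw_deg (- 1).
Proof. by apply/kmw_degP; exists TEta => //; exact: homog_eta. Qed.

Lemma kmw_deg_one : 1 \in kmw_deg 0.
Proof. by apply/kmw_degP; exists TOne => //; exact: homog_one. Qed.

Lemma kmw_deg_ang a : ang a \in kmw_deg 0.
Proof.
apply: rpredD kmw_deg_one _.
rewrite -[0]/(-1 + 1 : int); exact: kmw_degM kmw_deg_eta (kmw_deg_sym a).
Qed.

Lemma kmw_deg_angM n a (x : KMW n) : ang a * kmw_val x \in kmw_deg n.
Proof.
by rewrite -[X in kmw_deg X]add0r; apply: kmw_degM (kmw_deg_ang a) _; case: x.
Qed.

Lemma kmw_deg_etaM n (x : KMW n) : eta * kmw_val x \in kmw_deg (n - 1).
Proof. by rewrite [X in kmw_deg X]addrC; apply: kmw_degM kmw_deg_eta _; case: x. Qed.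

Definition angK (a : K) : KMW 0 := MkKMW (kmw_deg_ang a).
Definition angM n (a : K) (x : KMW n) : KMW n := MkKMW (kmw_deg_angM a x).
Definition etaM n (x : KMW n) : KMW (n - 1) := MkKMW (kmw_deg_etaM x).

Lemma etaC (x : KMWring) : eta * x = x * eta.
Proof.
have kE s t : kcls s * kcls t = kcls (TMul s t) by exact: kmulE.
rewrite -(kcls_repr x); elim: (repr x) => [a||||s ih|s ihs t iht|s ihs t iht].
- by rewrite !kE; exact/kcls_eq/kmw_etaC.
- by [].
- by rewrite -[kcls TZero]/(0 : KMWring) mul0r mulr0.
- by rewrite -[kcls TOne]/(1 : KMWring) mul1r mulr1.
- by rewrite -koppE -[kopp _]/(- kcls s) mulrN mulNr ih.
- by rewrite -kaddE -[kadd _ _]/(kcls s + kcls t) mulrDr mulrDl ihs iht.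
- by rewrite -kE mulrA ihs -mulrA iht mulrA.
Qed.

Section Twist.
Variable L : lmodType K.

(* The tensor product of KMW n with the free abelian group on L \ {0}, over the
   group ring of K^*: the pair (x, l) stands for x (x) l; the superfluous
   generators (x, 0) are set to zero. *)
Inductive twist_rel n :
  aterm (KMW n * L) -> aterm (KMW n * L) -> Prop :=
| twist_add x y l :
    twist_rel (AGen (x + y, l)) (AAdd (AGen (x, l)) (AGen (y, l)))
| twist_ang u x l : u != 0 ->
    twist_rel (AGen (angM u x, l)) (AGen (x, u *: l))
| twist_zero x : twist_rel (AGen (x, 0)) AZero.

Definition KMWt n := pgrp (@twist_rel n).
HB.instance Definition _ n := GRing.Zmodule.on (KMWt n).

Definition tens n (x : KMW n) (l : L) : KMWt n :=
  pgen (@twist_rel n) (x, l).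

Fact etat_rel n s t : @twist_rel n s t ->
  let f xl := tens (etaM xl.1) xl.2 in aeval f s = aeval f t.
Proof.
case=> [x y l|u x l u0|x] /=.
- have -> : etaM (x + y) = etaM x + etaM y.
    by apply/val_inj; rewrite /= mulrDr.
  rewrite [RHS]paddE; exact/pcls_eq/acong_rel/twist_add.
- have -> : etaM (angM u x) = angM u (etaM x).
    by apply/val_inj; rewrite /= !mulrA etaC.
  exact/pcls_eq/acong_rel/twist_ang.
- exact/pcls_eq/acong_rel/twist_zero.
Qed.

Definition etat n : KMWt n -> KMWt (n - 1) := plift (@etat_rel n).

End Twist.
End MilnorWitt.

Section GrothendieckWitt.
Variables (K : fieldType) (L : lmodType K).

Definition inner_product n (B : 'rV[K]_n -> 'rV[K]_n -> L) : Prop :=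
  [/\ forall a x y z, B (a *: x + y) z = a *: B x z + B y z,
      forall x y, B x y = B y x
    & forall x, (forall y, B x y = 0) -> x = 0].

(* Non-degenerate symmetric L-valued forms on the spaces K^n; every
   finite-dimensional K-vector space is isomorphic to one of these. *)
Record ips := Ips {
  ips_dim : nat;
  ips_form : 'rV[K]_ips_dim -> 'rV[K]_ips_dim -> L;
  ips_axiom : inner_product ips_form }.

Definition isometric (V W : ips) : Prop :=
  exists f : {linear 'rV[K]_(ips_dim V) -> 'rV[K]_(ips_dim W)},
    bijective f /\ forall x y, ips_form (f x) (f y) = ips_form x y.

Definition orth_form (V W : ips) (x y : 'rV[K]_(ips_dim V + ips_dim W)) : L :=
  ips_form (lsubmx x) (lsubmx y) + ips_form (rsubmx x) (rsubmx y).

Lemma ip0 (V : ips) (x : 'rV_(ips_dim V)) : ips_form x 0 = 0.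
Proof.
case: (ips_axiom V) => bl sy _; rewrite sy.
by have := bl (- 1) 0 0 x; rewrite scaler0 addr0 scaleN1r addNr.
Qed.

Lemma orth_axiom V W : inner_product (@orth_form V W).
Proof.
have [blV syV ndV] := ips_axiom V; have [blW syW ndW] := ips_axiom W.
split=> [a x y z|x y|x x0]; rewrite /orth_form.
- by rewrite !linearP /= blV blW scalerDr addrACA.
- by rewrite syV syW.
- rewrite -[x]hsubmxK; suff [-> ->] : lsubmx x = 0 /\ rsubmx x = 0.
    by rewrite row_mx0.
  split; [apply: ndV => y; have := x0 (row_mx y 0)
         |apply: ndW => y; have := x0 (row_mx 0 y)];
    by rewrite /orth_form row_mxKl row_mxKr ip0 ?addr0 ?add0r.
Qed.

Definition orth V W : ips := Ips (orth_axiom V W).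

Definition rank1_form (u : K) (l : L) (x y : 'rV[K]_1) : L :=
  (u * x 0 0 * y 0 0) *: l.

Lemma rank1_axiom u l : u != 0 -> l != 0 -> inner_product (rank1_form u l).
Proof.
move=> u0 l0; split=> [a x y z|x y|x x0]; rewrite /rank1_form.
- rewrite !mxE scalerA -scalerDl; congr (_ *: l).
  by rewrite mulrDr mulrDl; congr (_ + _); rewrite !mulrA [u * a]mulrC.
- by rewrite mulrAC.
- apply/rowP=> i; rewrite !ord1 mxE.
  have /eqP := x0 (const_mx 1).
  by rewrite /rank1_form !mxE mulr1 scaler_eq0 (negPf l0) orbF mulf_eq0
             (negPf u0) => /eqP.
Qed.

Definition rank1 u l (u0 : u != 0) (l0 : l != 0) : ips :=
  Ips (rank1_axiom u0 l0).

Inductive gw_rel : aterm ips -> aterm ips -> Prop :=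
| gw_isometric V W : isometric V W -> gw_rel (AGen V) (AGen W)
| gw_orth V W : gw_rel (AGen (orth V W)) (AAdd (AGen V) (AGen W)).

Definition GW := pgrp gw_rel.
HB.instance Definition _ := GRing.Zmodule.on GW.

Definition gwcls (V : ips) : GW := pgen gw_rel V.

(* K_0^MW is generated by the <u>, so these conditions determine phi: it is the
   canonical isomorphism. *)
Definition is_KMW0_to_GW (phi : KMWt L 0 -> GW) : Prop :=
  zmod_morphism phi /\
  forall (u : K) (l : L) (u0 : u != 0) (l0 : l != 0),
    phi (tens (angK u) l) = gwcls (rank1 u0 l0).

End GrothendieckWitt.

Section Transfer.
Variables (k : fieldType) (E : fieldExtType k).
Variables (tr : {scalar E}) (tr_neq0 : exists b, tr b != 0).

(* The coordinate isomorphism k^(n * [E : k]) -> E^n given by a k-basis of E *)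
Definition ext_scal n (x : 'rV[k]_(n * dim E)) : 'rV[E]_n :=
  \row_i r2v (row i (vec_mx x)).
Definition res_scal n (y : 'rV[E]_n) : 'rV[k]_(n * dim E) :=
  mxvec (\matrix_i v2r (y 0 i)).

Lemma ext_scalK n : cancel (@ext_scal n) (@res_scal n).
Proof.
move=> x; rewrite /ext_scal /res_scal -[RHS]vec_mxK; congr mxvec.
by apply/row_matrixP=> i; rewrite rowK mxE r2vK.
Qed.

Lemma res_scalK n : cancel (@res_scal n) (@ext_scal n).
Proof.
move=> y; apply/rowP=> i; rewrite /ext_scal /res_scal mxE mxvecK.
by rewrite rowK v2rK.
Qed.

Lemma ext_scalP n a (x y : 'rV[k]_(n * dim E)) :
  ext_scal (a *: x + y) = a%:A *: ext_scal x + ext_scal y.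
Proof.
by apply/rowP=> i; rewrite !mxE !linearP /= mulr_algl.
Qed.

Definition transfer_form (V : ips E^o) (x y : 'rV[k]_(ips_dim V * dim E)) :
  k^o := tr (ips_form (ext_scal x) (ext_scal y)).

Lemma transfer_axiom V : inner_product (@transfer_form V).
Proof.
have [bl sy nd] := ips_axiom V; split=> [a x y z|x y|x x0].
- rewrite /transfer_form ext_scalP bl.
  by rewrite /GRing.scale /= mulr_algl linearP.
- by rewrite /transfer_form sy.
apply: (can_inj (@ext_scalK _)).
have -> : ext_scal 0 = 0 :> 'rV_(ips_dim V).
  by apply/rowP=> i; rewrite !mxE !linear0.
apply: nd => y; apply/eqP; apply: contraT => Bxy0.
case: tr_neq0 => b /negP[].
have := x0 (res_scal ((b / ips_form (ext_scal x) y) *: y)).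
rewrite /transfer_form res_scalK sy -[_ *: y]addr0 bl.
by rewrite [ips_form 0 _]sy ip0 addr0 [ips_form y _]sy /GRing.scale /= divfK // => ->.
Qed.

Definition transfer_ips V : ips k^o := Ips (transfer_axiom V).

Lemma transfer_isometric (U : ips k^o) (W : ips E^o)
    (g : 'rV[k]_(ips_dim U) -> 'rV[E]_(ips_dim W)) :
  bijective g -> (forall a x y, g (a *: x + y) = a%:A *: g x + g y) ->
  (forall x y, ips_form x y = tr (ips_form (g x) (g y))) ->
  isometric U (transfer_ips W).
Proof.
move=> [h gK hK] gP gB.
have fP : linear (fun x => res_scal (g x)).
  move=> a x y; apply: (can_inj (@ext_scalK _)).
  by rewrite ext_scalP !res_scalK gP.
pose fM := GRing.isLinear.Build _ _ _ _ (fun x => res_scal (g x)) fP.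
pose f : {linear 'rV[k]_(ips_dim U) -> 'rV[k]_(ips_dim (transfer_ips W))} :=
  HB.pack (fun x => res_scal (g x)) fM.
exists f; split.
  exists (fun y => h (ext_scal y)) => x /=; first by rewrite res_scalK gK.
  by rewrite hK ext_scalK.
by move=> x y; rewrite /= /transfer_form !res_scalK gB.
Qed.

Fact transfer_rel s t : @gw_rel E E^o s t ->
  let f V := gwcls (transfer_ips V) in aeval f s = aeval f t.
Proof.
case=> [V W [f [fbij fB]]|V W] /=.
  apply/pcls_eq/acong_rel/gw_isometric.
  apply: (@transfer_isometric (transfer_ips V) W (fun x => f (ext_scal x))).
  - apply: bij_comp => //.
    by exists (@res_scal _); [exact: ext_scalK | exact: res_scalK].
  - by move=> a x y; rewrite ext_scalP linearP.
  - by move=> x y; rewrite fB.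
rewrite [RHS]paddE; apply/pcls_eq/(acong_trans _ (acong_rel (gw_orth _ _))).
apply/acong_sym/acong_rel/gw_isometric.
pose g (x : 'rV[k]_(ips_dim V * dim E + ips_dim W * dim E)) :=
  row_mx (ext_scal (lsubmx x)) (ext_scal (rsubmx x)).
apply: (@transfer_isometric (orth (transfer_ips V) (transfer_ips W))
          (orth V W) g).
- exists (fun y => row_mx (res_scal (lsubmx y)) (res_scal (rsubmx y))) => x.
    by rewrite /g row_mxKl row_mxKr !ext_scalK hsubmxK.
  by rewrite /g row_mxKl row_mxKr !res_scalK hsubmxK.
- move=> a x y; rewrite /g !linearP /= !ext_scalP.
  by rewrite scale_row_mx add_row_mx.
- move=> x y.
  by rewrite /= /orth_form /g !row_mxKl !row_mxKr raddfD.
Qed.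

Definition transfer : GW E^o -> GW k^o := plift transfer_rel.

Lemma transfer_gwcls V : transfer (gwcls V) = gwcls (transfer_ips V).
Proof. exact: plift_gen. Qed.

End Transfer.

Section ProjectiveLine.
Variable k : fieldType.

Notation kt := {fraction {poly k}}.
Notation "p %:F" := (@FracField.tofrac {poly k} p).

Definition affine_pt : Type :=
  {p : {poly k} | `[< irreducible_poly p >] && (p \is monic)}.
HB.instance Definition _ := Choice.on affine_pt.

(* None is the point at infinity. *)
Definition closed_pt : Type := option affine_pt.
HB.instance Definition _ := Choice.on closed_pt.

Lemma affine_ptP (p : affine_pt) : monic_irreducible_poly (val p).
Proof. by case: p => p /= /andP[/asboolP]. Qed.

Definition kappa (x : closed_pt) : fieldExtType k :=
  match x with
  | Some p => {poly %/ val p with affine_ptP p}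
  | None => k^o
  end.

Definition fnum (f : kt) : {poly k} :=
  \n_(repr f) %/ gcdp \n_(repr f) \d_(repr f).
Definition fden (f : kt) : {poly k} :=
  \d_(repr f) %/ gcdp \n_(repr f) \d_(repr f).

Definition multp (p q : {poly k}) : nat := \max_(i < size q | p ^+ i %| q) i.

(* The valuation of k(t) defined by x; only meaningful for f != 0 *)
Definition val_at (x : closed_pt) (f : kt) : int :=
  match x with
  | Some p => (multp (val p) (fnum f))%:Z - (multp (val p) (fden f))%:Z
  | None => (size (fden f))%:Z - (size (fnum f))%:Z
  end.

Definition unit_at x (f : kt) : bool := (f != 0) && (val_at x f == 0).
Definition uniformizer_at x (f : kt) : bool := (f != 0) && (val_at x f == 1).

(* The residue class of f; only meaningful for f in the valuation ring of x *)
Definition red (x : closed_pt) (f : kt) : kappa x :=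
  match x return kappa x with
  | Some p =>
      (in_qpoly (val p) (fnum f) / in_qpoly (val p) (fden f)
         : {poly %/ val p with affine_ptP p})
  | None => (fnum f)`_(size (fden f)).-1 / lead_coef (fden f)
  end.

(* The module of differentials of k(t) over k, in the basis dt *)
Definition Omega : lmodType kt := kt^o.

Definition dfrac (f : kt) : Omega :=
  let n := \n_(repr f) in let d := \d_(repr f) in
  (n^`() * d - n * d^`())%:F / (d ^+ 2)%:F.

Definition local_param (x : closed_pt) : kt :=
  match x with
  | Some p => (val p)%:F
  | None => ('X%:F)^-1
  end.

Definition local_form (x : closed_pt) : Omega :=
  match x with
  | Some p => dfrac 'X%:F
  | None => dfrac ('X%:F)^-1
  end.

(* The coordinate of a differential in the basis local_form x *)
Definition form_coord x (l : Omega) : kt := (l : kt) / (local_form x : kt).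

(* l generates the stalk at x of the canonical sheaf *)
Definition generator_at x (l : Omega) : bool := unit_at x (form_coord x l).

(* omega_{kappa_x/k}, identified with the twist (M_x/M_x^2)^* (x) omega|_x, in
   the basis formed by the dual of the class of local_param x, tensor the class
   of local_form x: this is pi_x^* (x) dt if x is affine, and s^* (x) ds at
   infinity. *)
Definition omega_pt (x : closed_pt) : lmodType (kappa x) := (kappa x)^o.

(* The element pi^* (x) l of omega_pt x, for a uniformizer pi and a generator l
   of the stalk; pi = u * local_param x has dual u^-1 * (local_param x)^*. *)
Definition twist_gen x (pi : kt) (l : Omega) : omega_pt x :=
  (red x (pi / local_param x))^-1 * red x (form_coord x l).

(* The last condition ties the degree n to the number of symbols, and states the
   formula through the underlying ring elements of s and r in order to avoid
   casts between n - 1 and size us. As KMW n is generated for n >= 1 by products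
   of symbols and their multiples by powers of eta, D n is determined by these
   conditions for all n >= 1. *)
Definition is_residue (x : closed_pt)
    (D : forall n, KMWt Omega n -> KMWt (omega_pt x) (n - 1)) : Prop :=
  [/\ forall n, zmod_morphism (D n),
      forall n (s : KMWt Omega n), D (n - 1) (etat s) = etat (D n s)
    & forall (pi v : kt) (m : int) (us : seq kt) (l : Omega)
        n (s : KMW kt n) (r : KMW (kappa x) (n - 1)),
      uniformizer_at x pi -> unit_at x v -> all (unit_at x) us ->
      generator_at x l ->
      n = (size us).+1 ->
      kmw_val s = sym (v * pi ^ m) * \prod_(u <- us) sym u ->
      kmw_val r = neps _ m * ang (red x v) * \prod_(u <- us) sym (red x u) ->
      D n (tens s l) = tens r (twist_gen x pi l)].

(* The trace form: for affine x, with alpha the class of t and d the degree of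
   its minimal polynomial, b is sent to the coefficient of alpha^(d-1). *)
Definition trace_omega (x : closed_pt) : kappa x -> k :=
  match x return kappa x -> k with
  | Some p => fun b : {poly %/ val p with affine_ptP p} =>
      (b : {poly k})`_(size (val p)).-2
  | None => fun b => b
  end.

Fact trace_omega_scalar x : scalar (@trace_omega x).
Proof.
by case: x => [p|] a b c //=; rewrite coefD coefZ.
Qed.

HB.instance Definition _ x :=
  GRing.isLinear.Build k (kappa x) k _ (@trace_omega x) (@trace_omega_scalar x).

Lemma trace_omega_neq0 x : exists b : kappa x, trace_omega b != 0.
Proof.
case: x => [p|]; last by exists (1 : k); exact: oner_neq0.
have [[sp _] _] := affine_ptP p.
exists (in_qpoly (val p) 'X^((size (val p)).-2)) => /=.
rewrite mk_monicE; last exact: affine_ptP.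
rewrite Pdiv.CommonRing.rmodp_small ?coefXn ?eqxx ?oner_neq0 //.
by rewrite size_polyXn; case: (size _) sp => [|[]].
Qed.

Definition transfer_pt (x : closed_pt) : GW (omega_pt x) -> GW k^o :=
  transfer (trace_omega_neq0 x).

End ProjectiveLine.

(* Main.v *)
(* Since eta [a][b] = [ab] - [a] - [b] and <d^2> = 1, the group K_1^MW(k(t)) is
   generated by the symbols [p^2] and [f] with p irreducible and f squarefree in
   k[t].  For f = c p_1 ... p_r of degree d, the Chinese remainder isomorphism
   (x_i) |-> sum_i x_i f / p_i identifies the orthogonal sum of the transfers of
   the residues <f / p_i> with k[t]/f carrying the form (a, b) |-> c tau(a b),
   where tau is the coefficient of t^(d-1).  Its Gram matrix in the basis of
   powers of t is a Hankel matrix vanishing above the antidiagonal, so its class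
   is floor(d/2) h, plus <c> if d is odd: this is minus the residue at infinity,
   where dt = - t^2 d(1/t). *)

Require Import Defs.
From HB Require Import structures.
From mathcomp Require Import all_boot all_order all_algebra all_field.
From mathcomp Require Import boolp classical_sets cardinality fsbigop.
From mathcomp Require Import ring zify.
Import Order.TTheory GRing.Theory Num.Theory.
Local Open Scope ring_scope.
Set Implicit Arguments.
Unset Strict Implicit.
Unset Printing Implicit Defensive.

(** * Classes of forms *)

(** The field is arbitrary, so forms can be neither diagonalized nor cancelled freely: in
    characteristic 2 a nondegenerate plane with an isotropic vector need not be hyperbolic. The Gram
    computations therefore end in equalities of classes in GW, where an auxiliary line <c> can be
    added to both sides and subtracted again, and not in isometries. The two sides of the
    reciprocity law meet in n_eps <c> = <c> + <-c> + <c> + ... (n terms): pairing consecutive lines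
    by <c> + <-c> = h gives the class of the Hankel form, while at infinity the same sum, negated,
    is the transferred residue of a polynomial of degree n with leading coefficient c, once d(1/t)
    is exchanged for dt. *)

Section FormClass.
Variables (K : fieldType) (L : lmodType K).

(** Nondegeneracy of the source makes a form-preserving linear map injective, and equality of
    dimensions then makes it bijective, so no inverse has to be exhibited. *)
Lemma isometricP (V W : ips L)
    (f : 'rV[K]_(ips_dim V) -> 'rV[K]_(ips_dim W)) :
  ips_dim V = ips_dim W -> linear f ->
  (forall x y, ips_form (f x) (f y) = ips_form x y) -> isometric V W.
Proof.
move=> dimE lin_f fB.
pose fM := GRing.isLinear.Build _ _ _ _ f lin_f.
pose g : {linear 'rV[K]_(ips_dim V) -> 'rV[K]_(ips_dim W)} := HB.pack f fM.
exists g; split; last exact: fB.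
have mulgE x : x *m lin1_mx g = f x by rewrite mul_rV_lin1.
have g_free : row_free (lin1_mx g).
  apply/inj_row_free => x; rewrite mulgE => fx0.
  have [[_ _ nd] [_ syW _]] := (ips_axiom V, ips_axiom W).
  by apply: nd => y; rewrite -fB fx0 syW ip0.
have g_full : row_full (lin1_mx g).
  by rewrite /row_full (eqP g_free) dimE.
exists (fun y => y *m pinvmx (lin1_mx g)) => [x|y] /=.
  by rewrite -mulgE mulmxKp.
by rewrite -mulgE mulmxKpV // submx_full.
Qed.

Lemma gwcls_isometric (V W : ips L) : isometric V W -> gwcls V = gwcls W.
Proof. by move=> VW; apply/pcls_eq/acong_rel/gw_isometric. Qed.

Lemma gwcls_orth (V W : ips L) : gwcls (orth V W) = gwcls V + gwcls W.
Proof. by rewrite [RHS]paddE; apply/pcls_eq/acong_rel/gw_orth. Qed.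

(** Total in [B], with placeholder value 0 when [B] is not an inner product, so that classes can be
    rewritten along equations between forms without transporting proofs. *)
Definition form_class n (B : 'rV[K]_n -> 'rV[K]_n -> L) : GW L :=
  if pselect (inner_product B) is left h then gwcls (Ips h) else 0.

Lemma form_classE n (B : 'rV[K]_n -> 'rV[K]_n -> L) (h : inner_product B) :
  form_class B = gwcls (Ips h).
Proof.
by rewrite /form_class; case: pselect => // h'; rewrite (Prop_irrelevance h h').
Qed.

Lemma gwclsE (V : ips L) : gwcls V = form_class (@ips_form _ _ V).
Proof. by case: V => n B h; rewrite (form_classE h). Qed.

Lemma form_class_split m1 m2 n (B1 : 'rV[K]_m1 -> 'rV[K]_m1 -> L)
    (B2 : 'rV[K]_m2 -> 'rV[K]_m2 -> L) (C : 'rV[K]_n -> 'rV[K]_n -> L)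
    (f : 'rV_(m1 + m2) -> 'rV_n) :
  inner_product B1 -> inner_product B2 -> inner_product C ->
  (m1 + m2)%N = n -> linear f ->
  (forall x y, C (f x) (f y) =
     B1 (lsubmx x) (lsubmx y) + B2 (rsubmx x) (rsubmx y)) ->
  form_class C = form_class B1 + form_class B2.
Proof.
move=> h1 h2 hC mn lin_f fB.
rewrite (form_classE h1) (form_classE h2) (form_classE hC) -gwcls_orth.
exact/esym/gwcls_isometric/(@isometricP (orth (Ips h1) (Ips h2)) (Ips hC) f).
Qed.

(** The zero-dimensional form is the orthogonal sum of two copies of itself, so its class equals its
    double. *)
Lemma form_class0 n (B : 'rV[K]_n -> 'rV[K]_n -> L) :
  n = 0%N -> inner_product B -> form_class B = 0.
Proof.
move=> n0; rewrite {n}n0 in B * => hB; apply: (@addrI _ (form_class B)); rewrite addr0.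
apply/esym; apply: (@form_class_split _ _ _ _ _ _ (fun=> 0)) => //.
- by move=> a x y; rewrite scaler0 addr0.
- have B0 y : B 0 y = 0.
    by case: hB => bl _ _; have := bl (- 1) 0 0 y; rewrite scaler0 addr0 scaleN1r addNr.
  by move=> x y; rewrite ![lsubmx _]thinmx0 ![rsubmx _]thinmx0 !B0 addr0.
Qed.

End FormClass.

(** * Lines and hyperbolic planes in every characteristic *)

Section Planes.
Variable k : fieldType.

Definition line_form (c : k) (x y : 'rV[k]_1) : k^o := c * x 0 0 * y 0 0.

Definition plane_form (c : k) (x y : 'rV[k]_2) : k^o :=
  x 0 0 * y 0 1 + x 0 1 * y 0 0 + c * (x 0 1 * y 0 1).

Definition line_class c : GW k^o := form_class (line_form c).

Definition hyp_class : GW k^o := form_class (plane_form 0).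

Lemma line_form_inner c : c != 0 -> inner_product (line_form c).
Proof.
move=> c0; split=> [a x y z|x y|x x0]; rewrite /line_form.
- by rewrite !mxE /GRing.scale /=; ring.
- by ring.
- apply/rowP => i; rewrite ord1 mxE; apply/eqP; move/eqP: (x0 (const_mx 1)).
  by rewrite /line_form mxE mulr1 mulf_eq0 (negPf c0).
Qed.

Lemma plane_form_inner c : inner_product (plane_form c).
Proof.
split=> [a x y z|x y|x x0]; rewrite /plane_form.
- by rewrite !mxE /GRing.scale /=; ring.
- by ring.
- have x1 : x 0 1 = 0.
    by have := x0 (delta_mx 0 0); rewrite /plane_form !mxE /= !(mulr0, mulr1,
      add0r, addr0).
  have x00 : x 0 0 = 0.
    have := x0 (delta_mx 0 1).
    by rewrite /plane_form x1 !mxE /= !(mulr0, mul0r, mulr1, addr0).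
  apply/rowP => -[[|[|//]] i]; rewrite mxE.
    by rewrite (_ : Ordinal i = 0) //; exact: val_inj.
  by rewrite (_ : Ordinal i = 1) //; exact: val_inj.
Qed.

Definition row2 (a b : k) : 'rV[k]_2 := \row_i (if i == 0 then a else b).

Lemma row2_0 a b : row2 a b 0 0 = a.
Proof. by rewrite mxE. Qed.

Lemma row2_1 a b : row2 a b 0 1 = b.
Proof. by rewrite mxE. Qed.

Lemma row2P a x y z t : a *: row2 x y + row2 z t = row2 (a * x + z) (a * y + t).
Proof. by apply/rowP => i; rewrite !mxE; case: ifP. Qed.

(* Replacing the basis (e, f, g) of [line_form c (+) plane_form d] by
   (e - c f, f, g + e) adds c to the value of the form on g. *)
Lemma plane_class_add c d : c != 0 ->
  form_class (plane_form (d + c)) = form_class (plane_form d).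
Proof.
move=> c0; apply: (@addrI _ (line_class c)).
have hc := line_form_inner c0.
pose V := Ips (line_form_inner c0).
pose P e := Ips (plane_form_inner e).
rewrite /line_class (form_classE hc) !(form_classE (plane_form_inner _)).
rewrite -!gwcls_orth; apply: gwcls_isometric.
pose f (x : 'rV[k]_(1 + 2)) : 'rV[k]_(1 + 2) :=
  row_mx ((lsubmx x 0 0 + rsubmx x 0 1)%:M : 'rV_1)
    (row2 (rsubmx x 0 0 - c * lsubmx x 0 0) (rsubmx x 0 1)).
apply: (@isometricP _ _ (orth V (P (d + c))) (orth V (P d)) f) => //.
  move=> a x y; rewrite /f scale_row_mx add_row_mx row2P // !mxE; congr row_mx.
    by apply/rowP => i; rewrite !ord1 !mxE eqxx !mulr1n; ring.
  by congr row2; ring.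
move=> x y; rewrite /= /orth_form /f !row_mxKl !row_mxKr /= /line_form /plane_form.
rewrite !row2_0 !row2_1; set a := lsubmx x; set b := lsubmx y.
set a' := rsubmx x; set b' := rsubmx y; rewrite !mxE /= !mulr1n; ring.
Qed.

(** An equality of classes only: in characteristic 2, for c nonzero, the two planes are not
    isometric, since only one of the forms is alternating. *)
Lemma plane_class c : form_class (plane_form c) = hyp_class.
Proof.
have [->//|c0] := eqVneq c 0.
by rewrite /hyp_class -(plane_class_add 0 c0) add0r.
Qed.

(** In the plane with e0 isotropic, e0.e1 = 1 and e1.e1 = c, the vectors e1 and e1 - c e0 are
    orthogonal with values c and -c. Choosing the diagonal value c avoids a division by 2. *)
Lemma line_classN c : c != 0 -> line_class c + line_class (- c) = hyp_class.
Proof.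
move=> c0; rewrite -(plane_class c); apply/esym.
apply: (@form_class_split _ _ _ _ _ _ _ _
  (fun x : 'rV_(1 + 1) => row2 (- c * rsubmx x 0 0) (lsubmx x 0 0 + rsubmx x 0 0))).
- exact: line_form_inner.
- by apply: line_form_inner; rewrite oppr_eq0.
- exact: plane_form_inner.
- by [].
- by move=> a x y; rewrite row2P // !mxE; congr row2; ring.
- move=> x y; rewrite /plane_form /line_form !row2_0 !row2_1; ring.
Qed.

End Planes.

(** * Residue forms on polynomials *)

Section PolyForms.
Variable k : fieldType.
Implicit Types (f g u p q : {poly k}) (tau : {scalar {poly k}}).

Definition poly_form n (tau : {poly k} -> k) (x y : 'rV[k]_n) : k^o :=
  tau (rVpoly x * rVpoly y).

Lemma poly_form_inner n tau :
  (forall x : 'rV_n, (forall y : 'rV_n, tau (rVpoly x * rVpoly y) = 0) -> x = 0) ->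
  inner_product (@poly_form n tau).
Proof.
move=> nd; split=> [a x y z|x y|//]; rewrite /poly_form.
- by rewrite linearP mulrDl -scalerAl linearP.
- by rewrite mulrC.
Qed.

Definition shift_form q (tau : {poly k} -> k) p := tau (q * p).

Fact shift_form_scalar q tau : scalar (shift_form q tau).
Proof. by move=> a x y; rewrite /shift_form mulrDr -scalerAr linearP. Qed.

HB.instance Definition _ q tau :=
  GRing.isLinear.Build k {poly k} k _ (shift_form q tau) (shift_form_scalar q tau).

(** The Gram entries are tau (X^(i+j)): 0 above the antidiagonal and c on it. The values of [tau] in
    degrees at least n, which are the entries below, stay free, and this makes the condition stable
    under the induction. *)
Definition hankel n (tau : {poly k} -> k) c :=
  forall p, (size p <= n)%N -> tau p = p`_n.-1 * c.

Lemma hankel_inner n tau c :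
  c != 0 -> hankel n tau c -> inner_product (@poly_form n tau).
Proof.
move=> c0 tauE; apply: poly_form_inner => x x0.
suff p0 : rVpoly x = 0 by rewrite -[x]rVpolyK p0 linear0.
apply/eqP; apply: contraT; set p := rVpoly x => p0.
have sp : (size p <= n)%N by exact: size_poly.
have sp0 : (0 < size p)%N by rewrite size_poly_gt0.
have sX : size ('X^(n - size p) : {poly k}) = (n - size p).+1 by rewrite size_polyXn.
(* This power of X moves the leading term of p to degree n - 1, where [tau] returns [lead_coef p]
   times c. *)
have := x0 (poly_rV 'X^(n - size p)).
rewrite poly_rV_K; last by lia.
rewrite -/p tauE; last by rewrite size_mulXn // subnK.
rewrite coefMXn ifF; last by lia.
have -> : (n.-1 - (n - size p) = (size p).-1)%N by lia.
move/eqP; rewrite -[_`__]/(lead_coef p) mulf_eq0 (negPf c0) orbF.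
by rewrite lead_coef_eq0 (negPf p0).
Qed.

Definition hankel_class n c : GW k^o :=
  hyp_class k *+ n./2 + (if odd n then line_class c else 0).

Lemma hankel_shift n tau c :
  hankel n.+2 tau c -> hankel n (shift_form 'X^2 tau) c.
Proof.
move=> tauE p sp; rewrite /shift_form tauE ?coefXnM.
  case: n sp {tauE} => [|n] sp; last by rewrite /= subn2.
  by move: sp; rewrite leqn0 size_poly_eq0 => /eqP->; rewrite !coef0.
rewrite (leq_trans (size_polyMleq _ _)) // size_polyXn. lia.
Qed.

(** By <c> + <-c> = h, the class is the alternating sum <c> + <-c> + <c> + ... with n terms, that is
    n_eps <c>, the shape in which residues at infinity appear. *)
Lemma hankel_classS n c : c != 0 ->
  hankel_class n.+1 c = hankel_class n c + line_class ((- 1) ^+ n * c).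
Proof.
move=> c0; rewrite /hankel_class /= -signr_odd uphalf_half.
case: (odd n); last by rewrite mul1r addr0.
by rewrite expr1 mulN1r -addrA line_classN // addr0 mulrS addrC.
Qed.

(* The first basis vector 1 is isotropic and pairs only with X^(n+1); they span
   a plane whose orthogonal is again of Hankel type, for tau (X^2 _). *)
Lemma hankel_split n tau c : c != 0 -> hankel n.+2 tau c ->
  form_class (@poly_form n.+2 tau)
  = hyp_class k + form_class (@poly_form n (shift_form 'X^2 tau)).
Proof.
move=> c0 tauE.
have tauE' := hankel_shift tauE.
pose w : {poly k} := 'X^(n.+1).
have sw : size w = n.+2 by rewrite size_polyXn.
(* The value of the form on w is uncontrolled, but the class of the plane does not depend on it. *)
rewrite -(plane_class (tau (w * w))).
(* The plane has basis c^-1 and w, whose pairing is tau(w) / c = 1. The subtracted multiple of 1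
   makes the image of each q orthogonal to w; X q is already orthogonal to 1. *)
pose al (x : 'rV[k]_(2 + n)) :=
  (lsubmx x 0 0 - tau ('X * w * rVpoly (rsubmx x))) / c.
pose f x : {poly k} := 'X * rVpoly (rsubmx x) + al x *: 1 + lsubmx x 0 1 *: w.
have sf x : (size (f x) <= n.+2)%N.
  apply: leq_trans (size_polyD _ _) _; rewrite geq_max; apply/andP; split; last first.
    by rewrite (leq_trans (size_scale_leq _ _)) ?sw.
  apply: leq_trans (size_polyD _ _) _; rewrite geq_max; apply/andP; split; last first.
    by rewrite (leq_trans (size_scale_leq _ _)) ?size_poly1.
  apply: leq_trans (size_polyMleq _ _) _; rewrite size_polyX.
  have : (size (rVpoly (rsubmx x)) <= n)%N by exact: size_poly.
  lia.
apply: (@form_class_split _ _ _ _ _ _ _ _ (fun x => poly_rV (f x))).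
- exact: plane_form_inner.
- exact: hankel_inner tauE'.
- exact: hankel_inner tauE.
- by [].
- move=> a x y; rewrite -linearP; congr poly_rV.
  rewrite /f scalerDr scalerDr addrACA; congr (_ + _); last first.
    by rewrite scalerA -scalerDl !mxE.
  rewrite addrACA; congr (_ + _).
    by rewrite scalerAr -mulrDr !linearP.
  rewrite scalerA -scalerDl; congr (_ *: _).
  rewrite /al !linearP /= mulrDr linearD -scalerAr linearZ /= !mxE; field.
  exact: c0.
- move=> x y; rewrite /poly_form !poly_rV_K // /plane_form /shift_form.
  have tw p : (size p <= n)%N -> tau ('X * p) = 0 /\ tau w = c.
    move=> sp; rewrite !tauE ?sw //; last first.
      by rewrite (leq_trans (size_polyMleq _ _)) // size_polyX; lia.
    rewrite /= coefXn eqxx mul1r coefXM /=; split=> //.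
    by rewrite nth_default ?mul0r.
  rewrite /f; set p := rVpoly (rsubmx x); set q := rVpoly (rsubmx y).
  have [tp _] : tau ('X * p) = 0 /\ tau w = c by apply: tw; exact: size_poly.
  have [tq twc] : tau ('X * q) = 0 /\ tau w = c by apply: tw; exact: size_poly.
  have t1 : tau 1 = 0 by rewrite tauE ?size_poly1 // coef1 mul0r.
  have -> : ('X * p + al x *: 1 + lsubmx x 0 1 *: w) *
            ('X * q + al y *: 1 + lsubmx y 0 1 *: w)
    = 'X^2 * (p * q) + (al y *: ('X * p) + al x *: ('X * q))
      + (al x * al y) *: 1 + (al x * lsubmx y 0 1 + al y * lsubmx x 0 1) *: w
      + (lsubmx x 0 1 *: ('X * w * q) + lsubmx y 0 1 *: ('X * w * p))
      + (lsubmx x 0 1 * lsubmx y 0 1) *: (w * w).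
    by rewrite -!mul_polyC !(polyCM, polyCD); ring.
  rewrite !(linearD, linearZ) /= tp tq t1 twc /al -/p -/q.
  by field.
Qed.

Lemma hankel_form_class n tau c : c != 0 -> hankel n tau c ->
  form_class (@poly_form n tau) = hankel_class n c.
Proof.
elim: {n}(S n) {-2}n (ltnSn n) tau => // m ih [|[|n]] nm tau c0 tauE.
- rewrite /hankel_class mulr0n addr0; apply: form_class0 => //.
  exact: hankel_inner c0 tauE.
- rewrite /hankel_class add0r; congr form_class.
  apply/funext => x; apply/funext => y; rewrite /poly_form /line_form tauE.
    have e (z : 'rV_1) : rVpoly z = (z 0 0)%:P.
      apply/polyP => i; rewrite coefC -[z 0 0]coef_rVpoly_ord /=.
      by case: i => // i; rewrite nth_default // (leq_trans (size_poly _ _)).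
    by rewrite !e -polyCM coefC /=; ring.
  apply: leq_trans (size_polyMleq _ _) _.
  have : (size (rVpoly x) <= 1)%N by exact: size_poly.
  have : (size (rVpoly y) <= 1)%N by exact: size_poly.
  lia.
- rewrite (hankel_split c0 tauE) (ih n _ _ c0 (hankel_shift tauE)) ?(ltn_trans
    _ nm) //; last lia.
  by rewrite /hankel_class /= negbK mulrS addrA.
Qed.

(** For monic f this is the coefficient of t^-1 in the expansion of u p / f at infinity. *)
Definition res_form f u p := ((u * p) %% f)`_(size f).-2.

Fact res_form_scalar f u : scalar (res_form f u).
Proof.
move=> a p q; rewrite /res_form mulrDr -scalerAr modpD modpZl.
by rewrite coefD coefZ.
Qed.

HB.instance Definition _ f u :=
  GRing.isLinear.Build k {poly k} k _ (res_form f u) (res_form_scalar f u).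

Definition res_class f u : GW k^o :=
  form_class (@poly_form (size f).-1 (res_form f u)).

Lemma hankel_res f c : f != 0 -> hankel (size f).-1 (res_form f c%:P) c.
Proof.
move=> f0 p sp; rewrite /res_form mul_polyC modpZl coefZ mulrC modp_small //.
by apply: leq_ltn_trans sp _; rewrite prednK ?size_poly_gt0.
Qed.

(** Multiplication by u is injective modulo f, which reduces nondegeneracy to u = 1, a Hankel form
    with c = 1. *)
Lemma res_form_inner f u : f != 0 -> coprimep f u ->
  inner_product (@poly_form (size f).-1 (res_form f u)).
Proof.
move=> f0 fu; apply: poly_form_inner => x x0.
have sf : ((size f).-1 < size f)%N by rewrite prednK ?size_poly_gt0.
have sx : (size (rVpoly x) < size f)%N by apply: leq_ltn_trans sf; exact: size_poly.
pose r := (u * rVpoly x) %% f.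
have sr : (size r <= (size f).-1)%N by rewrite -ltnS prednK ?size_poly_gt0 ?ltn_modp.
have := hankel_res 1 f0; rewrite polyC1 => h1.
have [_ _ nd] := hankel_inner (oner_neq0 k) h1.
have r0 : poly_rV r = 0 :> 'rV_(size f).-1.
  apply: nd => y; rewrite /poly_form poly_rV_K // -[RHS](x0 y).
  rewrite /= /res_form mul1r /r [in RHS]mulrA; congr (_`__).
  by rewrite mulrC modp_mul mulrC.
have : f %| u * rVpoly x by rewrite /dvdp -/r -[r](poly_rV_K sr) r0 linear0.
rewrite Gauss_dvdpr // => fx.
suff p0 : rVpoly x = 0 by rewrite -[x]rVpolyK p0 linear0.
apply/eqP; apply: contraTT sx => px0; rewrite -leqNgt.
exact: dvdp_leq.
Qed.

Lemma res_classC f c : f != 0 -> c != 0 ->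
  res_class f c%:P = hankel_class (size f).-1 c.
Proof. by move=> f0 c0; apply/hankel_form_class/hankel_res. Qed.

(** A common factor cancels in the fraction p / f: the remainder of p h modulo f h is (p mod f) h,
    and h monic keeps the coefficient in question. *)
Lemma res_formMr f h p : f != 0 -> h \is monic ->
  res_form (f * h) 1 (p * h) = res_form f 1 p.
Proof.
move=> f0 hm; have h0 := monic_neq0 hm; rewrite /res_form !mul1r.
have sf : (0 < size f)%N by rewrite size_poly_gt0.
have sh : (0 < size h)%N by rewrite size_poly_gt0.
have sM (a b : {poly k}) : a != 0 -> b != 0 -> size (a * b) = (size a + size b).-1.
  exact: size_mul.
have [r rE sr] : exists2 r : {poly k}, r = p %% f & (size r < size f)%N.
  by exists (p %% f); rewrite ?ltn_modp.
have <- : r * h = (p * h) %% (f * h).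
  apply: (@modpP _ _ (p %/ f)); first by rewrite {1}(divp_eq p f) rE; ring.
  have [->|r0] := eqVneq r 0; first by rewrite mul0r size_poly0 size_poly_gt0 mulf_neq0.
  by rewrite !sM //; lia.
rewrite sM // -rE.
have [->|r0] := eqVneq r 0; first by rewrite mul0r !coef0.
have [sE|sN] := eqVneq (size r) (size f).-1.
  have -> : (size f + size h).-1.-2 = (size (r * h)).-1 by rewrite sM // sE; lia.
  by rewrite -[LHS]/(lead_coef _) lead_coef_Mmonic // /lead_coef sE.
have s1 : (size r <= (size f).-2)%N by move/eqP: sN; lia.
have s2 : (size (r * h)%R <= (size f + size h).-1.-2)%N.
  by have : (0 < size r)%N; rewrite ?size_poly_gt0 // sM //; lia.
by rewrite !nth_default.
Qed.

(* The orthogonal decomposition k[t]/f (+) k[t]/g -> k[t]/fg is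
   (x, y) |-> x g + y f. *)
Lemma res_classM f g u : f \is monic -> g \is monic -> coprimep f g ->
  coprimep (f * g) u ->
  res_class (f * g) u = res_class f (g * u) + res_class g (f * u).
Proof.
move=> fm gm cfg cu; have f0 := monic_neq0 fm; have g0 := monic_neq0 gm.
have fg0 : f * g != 0 by rewrite mulf_neq0.
have sM : size (f * g) = (size f + size g).-1 by rewrite size_mul.
have sf : (0 < size f)%N by rewrite size_poly_gt0.
have sg : (0 < size g)%N by rewrite size_poly_gt0.
move: (cu); rewrite coprimepMl => /andP[cfu cgu].
pose n1 := (size f).-1; pose n2 := (size g).-1.
pose F (x : 'rV[k]_(n1 + n2)) := rVpoly (lsubmx x) * g + rVpoly (rsubmx x) * f.
have sF x : (size (F x) <= (size (f * g)%R).-1)%N.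
  have s1 : (size (rVpoly (lsubmx x)) <= n1)%N by exact: size_poly.
  have s2 : (size (rVpoly (rsubmx x)) <= n2)%N by exact: size_poly.
  apply: leq_trans (size_polyD _ _) _; rewrite sM geq_max; apply/andP; split;
  apply: leq_trans (size_polyMleq _ _) _; rewrite /n1 /n2 in s1 s2 *; lia.
apply: (@form_class_split _ _ _ _ _ _ _ _ (fun x => poly_rV (F x))).
- by apply: res_form_inner; rewrite // coprimepMr cfg.
- by apply: res_form_inner; rewrite // coprimepMr coprimep_sym cfg.
- exact: res_form_inner.
- rewrite sM; lia.
- move=> a x y; rewrite -linearP; congr poly_rV.
  by rewrite /F !linearP /= !mulrDl -!scalerAl scalerDr addrACA.
move=> x y; rewrite /poly_form !poly_rV_K // /F.
set a := rVpoly (lsubmx x); set b := rVpoly (lsubmx y).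
set c := rVpoly (rsubmx x); set d := rVpoly (rsubmx y).
(* The cross terms are multiples of f g and vanish in the remainder; each diagonal term keeps a
   spare factor g or f to cancel against the modulus. *)
transitivity (res_form (f * g) 1 ((g * u * (a * b)) * g) + res_form (g * f) 1
  ((f * u * (c * d)) * f)).
  rewrite [g * f]mulrC -linearD /= /res_form mul1r; congr (_`__).
  have -> : u * ((a * g + c * f) * (b * g + d * f)) =
    (g * u * (a * b) * g + f * u * (c * d) * f) + (u * (a * d + b * c)) * (f *
      g) by ring.
  by rewrite modpD modp_mull addr0.
by rewrite !res_formMr // /res_form !mul1r.
Qed.

(** The induction is over all u, because splitting off [F i] multiplies u by [F i] on the remaining
    factors. *)
Lemma res_class_prod (T : eqType) (s : seq T) (F : T -> {poly k}) u :
  uniq s -> {in s, forall i, F i \is monic} ->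
  {in s &, forall i j, i != j -> coprimep (F i) (F j)} ->
  {in s, forall i, coprimep (F i) u} ->
  res_class (\prod_(i <- s) F i) u =
  \sum_(i <- s) res_class (F i) (u * \prod_(j <- s | j != i) F j).
Proof.
elim: s u => [|i s ih] u.
  move=> _ _ _ _; rewrite !big_nil; apply: form_class0; first by rewrite size_poly1.
  by apply: res_form_inner; rewrite ?oner_neq0 ?coprime1p.
rewrite cons_uniq => /andP[i_s uq] mon cop copu.
have mon' : {in s, forall j, F j \is monic} by move=> j js; apply: mon;
  rewrite inE js orbT.
have cop' : {in s &, forall j l, j != l -> coprimep (F j) (F l)}.
  by move=> j l js ls; apply: cop; rewrite inE ?js ?ls orbT.
have cis : {in s, forall j, coprimep (F i) (F j)}.
  move=> j js; apply: cop; rewrite ?inE ?eqxx ?js ?orbT //.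
  by apply: contraNneq i_s => ->.
have copP v t : {in t, forall j, coprimep v (F j)} -> coprimep v (\prod_(j <- t) F j).
  move=> h; rewrite big_seq; elim/big_ind: _ => //; first exact: coprimep1.
  by move=> p q hp hq; rewrite coprimepMr hp.
rewrite !big_cons eqxx /= res_classM; first last.
- rewrite coprimep_sym coprimepMr coprimep_sym copu ?mem_head //=.
  by apply: copP => j js; rewrite coprimep_sym copu // inE js orbT.
- exact: copP.
- by rewrite big_seq; apply: monic_prod => j; exact: mon'.
- by rewrite mon ?mem_head.
congr (_ + _).
  rewrite mulrC; congr (res_class _ (_ * _)).
  rewrite [LHS]big_seq [RHS]big_seq_cond; apply: eq_bigl => j.
  by case: (boolP (j \in s)) => //= js; apply/esym; apply: contraNneq i_s => <-.
rewrite ih //; last first.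
  move=> j js; rewrite coprimepMr coprimep_sym cis // copu // inE js orbT //.
rewrite [LHS]big_seq [RHS]big_seq; apply: eq_bigr => j js; congr res_class.
rewrite big_cons ifT; first by rewrite mulrA [F i * u]mulrC.
by apply: contraNneq i_s => ->.
Qed.

End PolyForms.

(** * Transfers from residue fields *)

Section AffinePoint.
Variables (k : fieldType) (p : affine_pt k).
Local Notation P := (val p).
Local Notation E := (kappa (Some p)).

Lemma pt_monic : P \is monic.
Proof. by have [] := affine_ptP p. Qed.

Lemma pt_irreducible : irreducible_poly P.
Proof. by have [] := affine_ptP p. Qed.

Lemma pt_neq0 : P != 0.
Proof. exact/monic_neq0/pt_monic. Qed.

Definition qcls (v : {poly k}) : E := in_qpoly P v.

Lemma qcls_val v : (qcls v : {poly %/ P}) = v %% P :> {poly k}.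
Proof.
by rewrite /= (mk_monicE (affine_ptP p)) Pdiv.IdomainMonic.modpE ?pt_monic.
Qed.

Lemma val_qcls (q : E) : qcls (q : {poly %/ P}) = q.
Proof. by apply: val_inj; apply: in_qpoly_small; rewrite size_mk_monic. Qed.

Lemma size_kappa (q : E) : (size (polyseq (q : {poly %/ P})) <= (size P).-1)%N.
Proof.
rewrite -[in X in (_ <= X)%N](mk_monicE (affine_ptP p)) -ltnS.
by rewrite prednK ?size_mk_monic // size_mk_monic_gt0.
Qed.

Lemma qcls1 : qcls 1 = 1.
Proof. exact: in_qpoly1. Qed.

Lemma qcls0 : qcls 0 = 0.
Proof. exact: in_qpoly0. Qed.

Lemma qclsM u v : qcls (u * v) = qcls u * qcls v.
Proof. exact: in_qpolyM. Qed.

Lemma qclsP a u v : qcls (a *: u + v) = a%:A * qcls u + qcls v.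
Proof. by rewrite mulr_algl; exact: linearP. Qed.

Lemma qclsC c : qcls c%:P = c%:A.
Proof. by have := qclsP c 1 0; rewrite !addr0 qcls0 qcls1 mulr1 addr0 alg_polyC. Qed.

Lemma qcls_eq0 v : (qcls v == 0) = (P %| v).
Proof.
apply/eqP/idP => [v0|v0]; first by rewrite /dvdp -qcls_val v0.
by apply: val_inj; rewrite [LHS]qcls_val; exact/eqP.
Qed.

Lemma trace_qcls v : @trace_omega k (Some p) (qcls v) = res_form P 1 v.
Proof. by rewrite /res_form mul1r -qcls_val. Qed.

(** Representing the residue field by remainders modulo P turns the trace of v x y into the top
    coefficient of the remainder, which is [res_form P v]. *)
Lemma transfer_affine v (v0 : qcls v != 0) (l0 : (1 : omega_pt (Some p)) != 0) :
  transfer_pt (gwcls (rank1 v0 l0)) = res_class P v.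
Proof.
have cPv : coprimep P v.
  by rewrite irreducible_poly_coprime -?qcls_eq0 //; exact: pt_irreducible.
rewrite /transfer_pt transfer_gwcls /res_class.
rewrite (form_classE (res_form_inner pt_neq0 cPv)).
apply/esym/gwcls_isometric.
apply: (@transfer_isometric _ _ _ _ (Ips _) (rank1 v0 l0)
          (fun x => const_mx (qcls (rVpoly x)))).
- exists (fun y : 'rV[E]_1 => poly_rV (polyn (y 0 0 : {poly %/ P}))) => [x|y] /=.
    rewrite mxE qcls_val modp_small ?rVpolyK //.
    by apply: leq_ltn_trans (size_poly _ _) _; rewrite prednK ?size_poly_gt0 ?pt_neq0.
  apply/rowP => i; rewrite ord1 mxE poly_rV_K ?val_qcls //; exact: size_kappa.
- by move=> a x y; apply/rowP => i; rewrite !mxE linearP qclsP.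
- move=> x y; transitivity (@trace_omega k (Some p) (qcls (v * rVpoly x * rVpoly y))).
    by rewrite trace_qcls /res_form mul1r -mulrA.
  rewrite !qclsM -[RHS]/(trace_omega (rank1_form (qcls v) (1 : omega_pt (Some p)) _ _)).
  by rewrite /rank1_form !mxE; exact: (congr1 (@trace_omega k (Some p)) (esym
    (mulr1 _))).
Qed.

End AffinePoint.

Section InfinitePoint.
Variable k : fieldType.

Lemma transfer_infty (c : k) (c0 : (c : kappa None) != 0)
    (l0 : (1 : omega_pt (None : closed_pt k)) != 0) :
  transfer_pt (gwcls (rank1 c0 l0)) = line_class c.
Proof.
have c0' : c != 0 := c0.
rewrite /transfer_pt transfer_gwcls /line_class.
rewrite (form_classE (line_form_inner c0')).
apply/esym/gwcls_isometric.
apply: (@transfer_isometric _ _ _ _ (Ips _) (rank1 c0 l0) id).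
- by exists id.
- by move=> a x y; apply/rowP => i; rewrite !mxE mulr_algl.
- by move=> x y; rewrite /= /rank1_form /line_form /GRing.scale /= mulr1.
Qed.

End InfinitePoint.

(** * Generators of Milnor-Witt K-theory in degree 1 *)

Section KMWTheory.
Variable K : fieldType.
Local Notation KW := (KMWring K).
Local Notation "'[ a ]" := (@sym K a) (format "''[' a ]").
Local Notation et := (@Defs.eta K).
Local Notation h := (1 + 1 + et * '[- 1]).
Implicit Types (a b : K) (x y : KW).

Lemma kclsD (s t : kmw_term K) : kcls (TAdd s t) = kcls s + kcls t.
Proof. by rewrite -kaddE. Qed.

Lemma kclsM (s t : kmw_term K) : kcls (TMul s t) = kcls s * kcls t.
Proof. by rewrite -kmulE. Qed.

Lemma kclsN (s : kmw_term K) : kcls (TOpp s) = - kcls s.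
Proof. by rewrite -koppE. Qed.

Lemma sym_zero : '[0] = 0.
Proof. exact/kcls_eq/kmw_sym0. Qed.

Lemma sym_steinberg a : a != 0 -> a != 1 -> '[a] * '[1 - a] = 0.
Proof. by move=> a0 a1; have /kcls_eq := kmw_steinberg a0 a1; rewrite kclsM. Qed.

Lemma symM a b : a != 0 -> b != 0 ->
  '[a * b] = '[a] + '[b] + et * ('[a] * '[b]).
Proof. by move=> a0 b0; have /kcls_eq := kmw_symM a0 b0; rewrite !(kclsD, kclsM). Qed.

Lemma eta_hyp : et * h = 0.
Proof. by have /kcls_eq := kmw_hyp K; rewrite !(kclsD, kclsM). Qed.

Lemma eta_hyp_mul x : et * (x + x + et * ('[- 1] * x)) = 0.
Proof.
have -> : x + x + et * ('[- 1] * x) = h * x by rewrite !mulrDl !mul1r mulrA.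
by rewrite mulrA eta_hyp mul0r.
Qed.

(** Expanding [(-1)(-1)] and using the hyperbolic relation gives eta [1] = 0; then [1 * 1] = [1] +
    [1]. *)
Lemma sym_one : '[1] = 0.
Proof.
have N10 : (- 1 : K) != 0 by rewrite oppr_eq0 oner_eq0.
have e1 : et * '[1] = 0.
  rewrite -[X in sym X](mulr1 1) -[X in sym X]mulrNN symM //.
  exact: eta_hyp_mul.
have := symM (oner_neq0 K) (oner_neq0 K).
rewrite mulr1 [et * _]mulrA e1 mul0r addr0 => /eqP.
by rewrite -subr_eq0 opprD addNKr oppr_eq0 => /eqP.
Qed.

(** Compare the expansions of [a b] and [b a]. Without the factor eta, symbols commute only up to
    eps. *)
Lemma eta_symC a b : et * ('[a] * '[b]) = et * ('[b] * '[a]).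
Proof.
have [->|a0] := eqVneq a 0; first by rewrite sym_zero mulr0 mul0r.
have [->|b0] := eqVneq b 0; first by rewrite sym_zero mulr0 mul0r.
have := symM a0 b0; rewrite mulrC symM // ['[b] + _]addrC.
by move/addrI.
Qed.

(** Since 1 - a = (-a)(1 - a^-1), the Steinberg relation for a reads [a][-a] + <-a>[a][1 - a^-1] =
    0; the second term vanishes because [a] = - <a>[a^-1] turns it into a multiple of the Steinberg
    symbol of a^-1. *)
Lemma sym_mulN a : a != 0 -> '[a] * '[- a] = 0.
Proof.
move=> a0; have [->|a1] := eqVneq a 1; first by rewrite sym_one mul0r.
have b0 : a^-1 != 0 by rewrite invr_eq0.
have b1 : a^-1 != 1 by rewrite invr_eq1.
have Na0 : - a != 0 by rewrite oppr_eq0.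
have c0 : 1 - a^-1 != 0 by rewrite subr_eq0 eq_sym.
have aE : 1 - a = - a * (1 - a^-1) by rewrite mulrBr mulr1 mulNr divff // opprK addrC.
have symV : '[a] = - ((1 + et * '[a]) * '[a^-1]).
  have := symM a0 b0; rewrite divff // sym_one -addrA => /eqP.
  by rewrite eq_sym addr_eq0 => /eqP {1}->; rewrite mulrDl mul1r mulrA.
have := sym_steinberg a0 a1; rewrite aE symM // mulrDr mulrDr.
have -> : '[a] * (et * ('[- a] * '[1 - a^-1])) =
          et * '[- a] * '[a] * '[1 - a^-1].
  by rewrite mulrA -etaC -!mulrA ['[a] * (_ * _)]mulrA !mulrA -(mulrA (et))
    eta_symC mulrA.
rewrite -addrA; set r := (X in _ + X); suff -> : r = 0 by rewrite addr0.
have -> : r = (1 + et * '[- a]) * '[a] * '[1 - a^-1] by rewrite /r !mulrDl mul1r.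
by rewrite symV mulrN mulNr -!mulrA sym_steinberg // !mulr0 oppr0.
Qed.

(** From [b][-b] = 0 one gets [b][b] = [b][-1], and eta [b * b] becomes the hyperbolic relation
    times [b]. *)
Lemma eta_sym_sqr b : b != 0 -> et * '[b * b] = 0.
Proof.
move=> b0; have N10 : (- 1 : K) != 0 by rewrite oppr_eq0 oner_eq0.
have Nb0 : - b != 0 by rewrite oppr_eq0.
have bb : '[b] * '[b] = '[b] * '[- 1].
  have bE : '[b] = '[- b] + '[- 1] + et * ('[- b] * '[- 1]).
    by rewrite -symM // mulrN1 opprK.
  rewrite {2}bE !mulrDr sym_mulN // add0r.
  by rewrite mulrA -etaC mulrA -(mulrA (et)) sym_mulN // mulr0 mul0r addr0.
rewrite symM // bb eta_symC.
exact: eta_hyp_mul.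
Qed.

Lemma sym_mul_sqr a b : a != 0 -> b != 0 -> '[a * (b * b)] = '[a] + '[b * b].
Proof.
move=> a0 b0; rewrite symM ?mulf_neq0 // eta_symC.
by rewrite mulrA eta_sym_sqr // mul0r addr0.
Qed.

Lemma ang_mul a b : a != 0 -> b != 0 -> ang (a * b) = ang a * ang b.
Proof.
move=> a0 b0; rewrite /ang symM // mulrDl mul1r !mulrDr !mulr1 -!addrA.
congr (_ + _); rewrite addrCA; congr (_ + (_ + _)).
by rewrite -!mulrA; congr (_ * _); rewrite !mulrA etaC.
Qed.

Lemma ang_one : @ang K 1 = 1.
Proof. by rewrite /ang sym_one mulr0 addr0. Qed.

Lemma ang_sym a b : a != 0 -> b != 0 -> ang a * '[b] = '[a * b] - '[a].
Proof.
move=> a0 b0; apply/esym/eqP.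
by rewrite subr_eq symM // /ang mulrDl mul1r mulrA -addrA addrC.
Qed.

(** Centrality of eta allows all its powers to stand in front of the symbols, so homogeneous
    elements are generated by these monomials. *)
Inductive kmw_span (n : int) : KW -> Prop :=
| kmw_span0 : kmw_span n 0
| kmw_spanB x y : kmw_span n x -> kmw_span n y -> kmw_span n (x - y)
| kmw_span_sym j us : (size us)%:Z - j%:Z = n ->
    kmw_span n (et ^+ j * \prod_(u <- us) '[u]).

Lemma kmw_spanN n x : kmw_span n x -> kmw_span n (- x).
Proof. by rewrite -sub0r; apply: kmw_spanB; exact: kmw_span0. Qed.

Lemma kmw_spanD n x y : kmw_span n x -> kmw_span n y -> kmw_span n (x + y).
Proof. by move=> hx hy; rewrite -[y]opprK; apply/kmw_spanB/kmw_spanN. Qed.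

Lemma kmw_spanM m n x y : kmw_span m x -> kmw_span n y -> kmw_span (m + n) (x * y).
Proof.
move=> hx; elim: hx y => {x} [|x x' _ ihx _ ihx'|i us ei] y.
- by rewrite mul0r => _; exact: kmw_span0.
- by move=> hy; rewrite mulrBl; apply: kmw_spanB; [exact: ihx | exact: ihx'].
elim=> {y} [|y y' _ ihy _ ihy'|j vs ej].
- by rewrite mulr0; exact: kmw_span0.
- by rewrite mulrBr; exact: kmw_spanB.
have etaXC z l : z * et ^+ l = et ^+ l * z.
  by elim: l z => [|l ih] z; rewrite ?expr0 ?mulr1 ?mul1r // exprS mulrA -etaC
    -!mulrA ih.
rewrite mulrA -(mulrA _ _ (et ^+ j)) etaXC mulrA -exprD -mulrA -big_cat.
by apply: kmw_span_sym; rewrite size_cat -ei -ej !PoszD; lia.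
Qed.

Lemma kmw_homog_span n t : kmw_homog n t -> kmw_span n (kcls t).
Proof.
elim=> {n t} [a||||n s _ hs|n s t _ hs _ ht|m n s t _ hs _ ht].
- rewrite -[kcls _]mul1r; have := @kmw_span_sym 1 0 [:: a] erefl.
  by rewrite big_seq1.
- have := @kmw_span_sym (- 1) 1 [::] erefl.
  by rewrite big_nil mulr1.
- by move=> n; exact: kmw_span0.
- by have := @kmw_span_sym 0 0 [::] erefl; rewrite big_nil mulr1.
- by rewrite kclsN; exact: kmw_spanN.
- by rewrite kclsD; exact: kmw_spanD.
- by rewrite kclsM; exact: kmw_spanM.
Qed.

Definition symK a : KMW K 1 := MkKMW (kmw_deg_sym a).

Lemma angM_symK a b : a != 0 -> b != 0 -> angM a (symK b) = symK (a * b) - symK a.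
Proof. by move=> a0 b0; apply: val_inj; rewrite /= ang_sym. Qed.

Lemma symK_mul_sqr a b : a != 0 -> b != 0 ->
  symK (a * (b * b)) = symK a + symK (b * b).
Proof. by move=> a0 b0; apply: val_inj; rewrite /= sym_mul_sqr. Qed.

(* eta [a] [b] = [a b] - [a] - [b] removes all the factors eta in degree 1. *)
Lemma KMW1_ind (Q : KMW K 1 -> Prop) :
  Q 0 -> (forall x y : KMW K 1, Q x -> Q y -> Q (x - y)) ->
  (forall a, a != 0 -> Q (symK a)) -> forall x : KMW K 1, Q x.
Proof.
move=> Q0 QB Qsym x.
pose P z := exists2 y : KMW K 1, kmw_val y = z & Q y.
suff : P (kmw_val x) by case=> y /val_inj ->.
have P0 : P 0 by exists 0.
have PB u v : P u -> P v -> P (u - v).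
  by move=> [a <- ha] [b <- hb]; exists (a - b) => //; exact: QB.
have /kmw_degP[t ht ->] : kmw_val x \in @kmw_deg K 1 by case: x.
elim: (kmw_homog_span ht) => [//|u v _ hu _ hv|j us]; first exact: PB.
elim: j us => [|j ih] [|a [|b us]] //= e.
  rewrite big_seq1 mul1r; have [->|a0] := eqVneq a 0; first by rewrite sym_zero.
  by exists (symK a) => //; exact: Qsym.
- by lia.
rewrite !big_cons.
have -> : et ^+ j.+1 * ('[a] * ('[b] * \prod_(u <- us) '[u])) =
  et ^+ j * (et * ('[a] * '[b]) * \prod_(u <- us) '[u]).
  by rewrite exprSr !mulrA.
have [->|a0] := eqVneq a 0; first by rewrite sym_zero mul0r mulr0 mul0r mulr0.
have [->|b0] := eqVneq b 0; first by rewrite sym_zero !mulr0 mul0r mulr0.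
have -> : et * ('[a] * '[b]) = '[a * b] - '[a] - '[b].
  by rewrite symM // -[RHS]addrA -opprD [X in X - _]addrC addrK.
have {}ih c : P (et ^+ j * ('[c] * \prod_(u <- us) '[u])).
  by have := ih (c :: us); rewrite big_cons; apply => /=; lia.
by rewrite !mulrBl !mulrBr; apply: (PB) => //; exact: PB.
Qed.

End KMWTheory.

(** * Valuations of rational functions *)

Section Fractions.
Variable k : fieldType.
Local Notation kt := {fraction {poly k}}.
Local Notation "p %:F" := (@FracField.tofrac {poly k} p).
Implicit Types (n d g e : {poly k}) (f : kt).

Lemma frac_repr f : f * (\d_(repr f))%:F = (\n_(repr f))%:F.
Proof.
elim/quotW: f => x; unlock FracField.tofrac; rewrite -[LHS]FracField.pi_mul.
apply/eqmodP; rewrite /= FracField.equivfE /FracField.mulf /=.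
rewrite !numden_Ratio ?mulf_neq0 ?oner_neq0 ?denom_ratioP // !mulr1.
by rewrite FracField.equivf_r.
Qed.

Lemma frac_cross n d f : d != 0 -> f = n%:F / d%:F ->
  n * \d_(repr f) = \n_(repr f) * d.
Proof.
move=> d0 fE; apply/eqP; rewrite -(tofrac_eq (_ * _)) !tofracM -frac_repr {2}fE.
by rewrite mulrAC divfK ?tofrac_eq0.
Qed.

(** [fnum] and [fden] come from an unknown representative of the fraction. Any n / d is a common
    multiple of this coprime pair, which makes valuations and residue classes computable from the n
    and d at hand. *)
Lemma fnum_fden n d : d != 0 -> exists2 e, e != 0 &
  n = e * fnum (n%:F / d%:F) /\ d = e * fden (n%:F / d%:F).
Proof.
move=> d0; set f := _ / _; have cross := frac_cross d0 (erefl f).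
pose N := \n_(repr f); pose D := \d_(repr f); pose g := gcdp N D.
have D0 : D != 0 by exact: denom_ratioP.
have g0 : g != 0 by rewrite gcdp_eq0 negb_and D0 orbT.
have NE : fnum f * g = N by rewrite /fnum divpK ?dvdp_gcdl.
have DE : fden f * g = D by rewrite /fden divpK ?dvdp_gcdr.
have fd0 : fden f != 0 by apply: contraNneq D0 => fd0; rewrite -DE fd0 mul0r.
have cop : coprimep (fden f) (fnum f).
  by rewrite coprimep_sym; apply: coprimep_div_gcd; rewrite D0 orbT.
have crossg : n * fden f = fnum f * d.
  by apply: (mulIf g0); rewrite -mulrA DE mulrAC NE.
have /dvdpP[e dE] : fden f %| d by rewrite -(Gauss_dvdpr _ cop) -crossg dvdp_mull.
have e0 : e != 0 by apply: contraNneq d0 => e0; rewrite dE e0 mul0r.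
by exists e => //; split=> //; apply: (mulIf fd0); rewrite crossg dE; ring.
Qed.

Lemma fnum_fden_poly g : exists2 c, c != 0 &
  fnum g%:F = c *: g /\ fden g%:F = c%:P.
Proof.
have [e e0] := fnum_fden g (oner_neq0 {poly k}).
rewrite tofrac1 divr1 => -[gE dE].
have /size_poly1P[c c0 eE] : size e == 1.
  by rewrite -dvdp1 [X in _ %| X]dE dvdp_mulr.
exists c^-1; rewrite ?invr_eq0 //.
have eV : c^-1 *: e = 1 by rewrite eE -mul_polyC -polyCM mulVf.
split; first by rewrite {2}gE scalerAl eV mul1r.
by rewrite -[LHS]mul1r -eV -scalerAl -dE alg_polyC.
Qed.

(** The chosen representative n / d of t is unknown; n = t d is enough for the quotient rule to give
    d^2 / d^2. *)
Lemma dfracX : dfrac ('X%:F : kt) = 1 :> kt.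
Proof.
rewrite /dfrac; have := @frac_cross 'X 1 ('X%:F) (oner_neq0 _).
rewrite tofrac1 divr1 mulr1 => /(_ erefl) nE.
have d0 := denom_ratioP (repr ('X%:F : kt)).
rewrite -nE derivM derivX; set d := \d_ _ in d0 *.
have -> : (1 * d + 'X * d^`()) * d - 'X * d * d^`() = d ^+ 2 by ring.
by rewrite divff // tofrac_eq0 expf_neq0.
Qed.

Lemma dfracV : dfrac (('X%:F)^-1 : kt) = - (('X ^+ 2)%:F)^-1 :> kt.
Proof.
have X0 : 'X != 0 :> {poly k} by rewrite polyX_eq0.
rewrite /dfrac; have := @frac_cross 1 'X (('X%:F)^-1) X0.
rewrite tofrac1 mul1r mul1r => /(_ erefl) dE.
have d0 := denom_ratioP (repr (('X%:F)^-1 : kt)).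
rewrite dE in d0 *; rewrite derivM derivX; set n := \n_ _ in d0 *.
have -> : n^`() * (n * 'X) - n * (n^`() * 'X + n * 1) = - n ^+ 2 by ring.
have n0 : n != 0 by apply: contraNneq d0 => ->; rewrite mul0r.
rewrite exprMn tofracM tofracN mulNr; congr (- _).
by rewrite invfM mulrA divff ?mul1r // tofrac_eq0 expf_neq0.
Qed.

Lemma multp_eq0 (p q : {poly k}) : ~~ (p %| q) -> multp p q = 0%N.
Proof.
move=> npq; apply/eqP; rewrite -leqn0; apply/bigmax_leqP => i pq.
rewrite leqNgt; apply: contra npq => i0; apply: dvdp_trans pq.
by case: (i : nat) i0 => // j _; rewrite exprS dvdp_mulr.
Qed.

Lemma multp_self (p : {poly k}) c : (1 < size p)%N -> c != 0 -> multp p (c *: p) = 1%N.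
Proof.
move=> sp c0; have sq : size (c *: p) = size p by rewrite size_scale.
have p0 : p != 0 by rewrite -size_poly_gt0 (ltn_trans _ sp).
apply/eqP; rewrite eqn_leq; apply/andP; split; last first.
  have i1 : (1 < size (c *: p)%R)%N by rewrite sq.
  by apply: (@leq_bigmax_cond _ _ (fun i : 'I_ _ => i : nat) (Ordinal i1));
    rewrite /= expr1 dvdpZr.
apply/bigmax_leqP => i; rewrite dvdpZr // => pq; rewrite leqNgt; apply/negP => i1.
have /(dvdp_trans) : p ^+ 2 %| p ^+ i by rewrite dvdp_exp2l.
move=> /(_ _ pq) /(dvdp_leq p0); rewrite expr2.
have -> : size (p * p) = (size p + size p).-1 by exact: size_mul.
by move: sp; case: (size p) => [|[|m]] // _; rewrite addSn /= ltnNge leq_addl.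
Qed.

Lemma val_at_infty n d : n != 0 -> d != 0 ->
  val_at None (n%:F / d%:F) = (size d)%:Z - (size n)%:Z.
Proof.
move=> n0 d0; rewrite /val_at.
move: (n%:F / d%:F) (fnum_fden n d0) => f [e e0 [nE dE]].
have fn0 : fnum f != 0 by apply: contraNneq n0 => f0; rewrite nE f0 mulr0.
have fd0 : fden f != 0 by apply: contraNneq d0 => f0; rewrite dE f0 mulr0.
have sM (a : {poly k}) : a != 0 -> size (e * a) = (size e + size a).-1.
  exact: size_mul.
rewrite nE dE !sM //; move: e0 fn0 fd0; rewrite -!size_poly_gt0; lia.
Qed.

Lemma red_infty n d : n != 0 -> d != 0 -> size n = size d ->
  red None (n%:F / d%:F) = lead_coef n / lead_coef d :> k.
Proof.
move=> n0 d0 snd; have /eqP := val_at_infty n0 d0.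
rewrite snd subrr subr_eq0 /val_at /red => /eqP[].
move: (n%:F / d%:F) (fnum_fden n d0) => f [e e0 [-> ->]] ->.
rewrite -[_`__]/(lead_coef _) !lead_coefM.
by rewrite -mulf_div divff ?mul1r // lead_coef_eq0.
Qed.

Lemma val_at_affine (p : affine_pt k) g : ~~ (val p %| g) -> val_at (Some p) g%:F = 0.
Proof.
move=> npg; have [c c0 [nE dE]] := fnum_fden_poly g.
rewrite /val_at nE dE !multp_eq0 ?subrr ?dvdpZr //.
apply/negP => /dvdp_leq; rewrite polyC_eq0 c0 size_polyC c0.
by move=> /(_ isT); have [[sp _] _] := affine_ptP p; lia.
Qed.

Lemma val_at_self (p : affine_pt k) : val_at (Some p) (val p)%:F = 1.
Proof.
have [[sp _] _] := affine_ptP p.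
have [c c0 [nE dE]] := fnum_fden_poly (val p).
rewrite /val_at nE dE multp_self // multp_eq0 //.
apply/negP => /dvdp_leq; rewrite polyC_eq0 c0 size_polyC c0.
by move=> /(_ isT); lia.
Qed.

Lemma red_affine (p : affine_pt k) g : red (Some p) g%:F = qcls p g.
Proof.
have [c c0 [nE dE]] := fnum_fden_poly g.
rewrite /red nE dE -!/(qcls p _).
have c1 : qcls p c%:P != 0 by rewrite qclsC scaler_eq0 negb_or c0; exact: oner_neq0.
have -> : qcls p (c *: g) = qcls p g * qcls p c%:P.
  by rewrite -qclsM mulrC mul_polyC.
exact: mulfK c1 _.
Qed.

End Fractions.

(** * Irreducible factors and squares in k[t] *)

Section Factorization.
Variable k : fieldType.
Implicit Types (f g : {poly k}) (p q : affine_pt k).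

Lemma pt_dvd_eq p q : val p %| val q -> p = q.
Proof.
have [[sp _] mp] := affine_ptP p; have [[_ iq] mq] := affine_ptP q.
move=> pq; apply: val_inj; apply/eqP.
by rewrite -eqp_monic ?mp ?mq //; apply: iq; rewrite // gtn_eqF.
Qed.

Lemma pt_coprime p f : ~~ (val p %| f) -> coprimep (val p) f.
Proof. by rewrite irreducible_poly_coprime //; exact: pt_irreducible. Qed.

Lemma exists_pt_dvd f : (1 < size f)%N -> exists p, val p %| f.
Proof.
elim: {f}(size f) {-2}f (leqnn (size f)) => [|n ih] f; first by case: (size f).
move=> fn f1; have f0 : f != 0 by rewrite -size_poly_gt0 (ltn_trans _ f1).
have [irr|nirr] := pselect (irreducible_poly f).
  have lc0 : (lead_coef f)^-1 != 0 by rewrite invr_eq0 lead_coef_eq0.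
  pose g := (lead_coef f)^-1 *: f.
  have gm : g \is monic by rewrite monicE lead_coefZ mulVf // lead_coef_eq0.
  have girr : irreducible_poly g.
    split=> [|q q1]; rewrite ?size_scale // dvdpZr // => /(irr.2 _ q1) qf.
    by rewrite (eqp_trans qf) // eqp_sym eqp_scale.
  have gP : `[< irreducible_poly g >] && (g \is monic) by rewrite gm andbT;
    apply/asboolP.
  by exists (exist _ g gP); rewrite /= /g dvdpZl.
have [g [g1 gf ngf]] : exists g, [/\ size g != 1%N, g %| f & ~~ (g %= f)].
  apply: contrapT => no; apply: nirr; split=> // g g1 gf.
  by apply: contrapT => /negP ngf; apply: no; exists g.
have g0 : g != 0 by apply: contraNneq f0 => g0; move: gf; rewrite g0 dvd0p.
have gs : (size g < size f)%N.
  by rewrite ltn_neqAle dvdp_leq // andbT dvdp_size_eqp.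
have [|p pg] := ih g (leq_trans gs fn).
  by rewrite ltn_neqAle eq_sym g1 size_poly_gt0.
by exists p; exact: dvdp_trans gf.
Qed.

(** Write f = g p with p irreducible: when g is squarefree, p is either a new factor or the source
    of a square, and a square in g persists in f. In the second case the symbol [p^2] splits off
    from [f]. *)
Lemma squarefree_or_sqr f : f != 0 ->
  (exists (c : k) (s : seq (affine_pt k)), [/\ c != 0, uniq s & f = c%:P *
    \prod_(p <- s) val p]) \/
  (exists (p : affine_pt k) (g : {poly k}), f = g * (val p * val p)).
Proof.
elim: {f}(size f) {-2}f (leqnn (size f)) => [|n ih] f.
  by rewrite leqn0 size_poly_eq0 => ->.
move=> fn f0; have [f1|f1] := leqP (size f) 1.
  left; have /size_poly1P[c c0 ->] : size f == 1%N.
    by rewrite eqn_leq f1 size_poly_gt0.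
  by exists c, [::]; rewrite big_nil mulr1.
have [p /dvdpP[g fE]] := exists_pt_dvd f1.
have g0 : g != 0 by apply: contraNneq f0 => g0; rewrite fE g0 mul0r.
have [|[c [s [c0 us gE]]]|[q [g' gE]]] := ih g _ g0.
- have [[sp _] _] := affine_ptP p.
  have sE : size f = (size g + size (val p)).-1 by rewrite fE size_mul // pt_neq0.
  by move: fn; rewrite sE -(subnKC sp) addnA addn2 /= addSn ltnS; apply: leq_trans;
    exact: leq_addr.
- have [ps|ps] := boolP (p \in s).
    right; exists p, (c%:P * \prod_(q <- rem p s) val q).
    by rewrite fE gE (big_rem p ps) /=; ring.
  left; exists c, (p :: s); split; rewrite //= ?ps //.
  by rewrite fE gE big_cons /=; ring.
- by right; exists q, (g' * val p); rewrite fE gE; ring.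
Qed.

End Factorization.

(** * Residues and reciprocity *)

Section Tens.
Variables (K : fieldType) (L : lmodType K).

Lemma tensD n (x y : KMW K n) (l : L) : tens (x + y) l = tens x l + tens y l.
Proof. by rewrite [RHS]paddE; exact/pcls_eq/acong_rel/twist_add. Qed.

Lemma tens0l n (l : L) : tens (0 : KMW K n) l = 0.
Proof. by apply: (@addrI _ (tens (0 : KMW K n) l)); rewrite -tensD !addr0. Qed.

Lemma tensB n (x y : KMW K n) (l : L) : tens (x - y) l = tens x l - tens y l.
Proof. by apply: (@addIr _ (tens y l)); rewrite -tensD !subrK. Qed.

Lemma tens0r n (x : KMW K n) : tens x (0 : L) = 0.
Proof. exact/pcls_eq/acong_rel/twist_zero. Qed.

Lemma tens_ang n u (x : KMW K n) (l : L) : u != 0 ->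
  tens (angM u x) l = tens x (u *: l).
Proof. by move=> u0; exact/pcls_eq/acong_rel/twist_ang. Qed.

End Tens.

Section LocalTerms.
Variables (k : fieldType).
Local Notation kt := {fraction {poly k}}.
Local Notation "p %:F" := (@FracField.tofrac {poly k} p).
Variables (partial : forall (x : closed_pt k) (n : int),
  KMWt (Omega k) n -> KMWt (omega_pt x) (n - 1)).
Variable gw : forall x : closed_pt k, KMWt (omega_pt x) 0 -> GW (omega_pt x).
Arguments partial : clear implicits.
Arguments gw : clear implicits.
Hypothesis partialP : forall x, is_residue (partial x).
Hypothesis gwP : forall x, is_KMW0_to_GW (gw x).
Implicit Types (x : closed_pt k) (p : affine_pt k) (f g : {poly k}).

Definition trace_ang x (r : KMW (kappa x) 0) : GW k^o :=
  transfer_pt (gw x (tens r (1 : omega_pt x))).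

Definition local_term x (s : KMWt (Omega k) 1) : GW k^o :=
  transfer_pt (gw x (partial x 1 s)).

Lemma transfer_ptB x (a b : GW (omega_pt x)) :
  transfer_pt (a - b) = transfer_pt a - transfer_pt b.
Proof. exact: plift_is_zmod_morphism. Qed.

Lemma local_termB x s t : local_term x (s - t) = local_term x s - local_term x t.
Proof.
have [partB _ _] := partialP x; have [gwB _] := gwP x.
by rewrite /local_term partB (gwB (partial x 1 s)) transfer_ptB.
Qed.

Lemma local_term0 x : local_term x 0 = 0.
Proof. by rewrite -[X in local_term x X](subrr 0) local_termB subrr. Qed.

Lemma trace_angB x r s : @trace_ang x (r - s) = trace_ang r - trace_ang s.
Proof.
have [gwB _] := gwP x.
by rewrite /trace_ang tensB gwB transfer_ptB.
Qed.

Lemma trace_ang0 x : @trace_ang x 0 = 0.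
Proof. by rewrite -[X in trace_ang X](subrr 0) trace_angB subrr. Qed.

Lemma trace_angD x r s : @trace_ang x (r + s) = trace_ang r + trace_ang s.
Proof. by rewrite -[s in LHS]opprK trace_angB -[- s]sub0r trace_angB trace_ang0
  sub0r opprK. Qed.

Lemma trace_ang_affine p v : ~~ (val p %| v) ->
  @trace_ang (Some p) (angK (qcls p v)) = res_class (val p) v.
Proof.
rewrite -qcls_eq0 => v0; have l0 : (1 : omega_pt (Some p)) != 0 by exact: oner_neq0.
have [_ gwE] := gwP (Some p).
by rewrite /trace_ang (gwE _ _ v0 l0) transfer_affine.
Qed.

Lemma trace_ang_infty (c : k) : c != 0 ->
  @trace_ang None (angK (c : kappa None)) = line_class c.
Proof.
move=> c0; have l0 : (1 : omega_pt (None : closed_pt k)) != 0 by exact: oner_neq0.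
have [_ gwE] := gwP None.
by rewrite /trace_ang (gwE _ _ c0 l0) transfer_infty.
Qed.

(** * Local terms at affine points *)

Lemma unit_at_affine p g : ~~ (val p %| g) -> unit_at (Some p) g%:F.
Proof.
move=> npg; rewrite /unit_at val_at_affine // eqxx andbT tofrac_eq0.
by apply: contraNneq npg => ->; rewrite dvdp0.
Qed.

Lemma pt_ndvd1 p : ~~ (val p %| 1).
Proof. by have [[sp _] _] := affine_ptP p; rewrite dvdp1;
  case: (size _) sp => [|[]]. Qed.

(** At an affine point dt generates the stalk and the monic polynomial is the local parameter, so
    the twist in the residue formula is 1 and only m_eps <g> remains. *)
Lemma local_term_affine p f g (m : nat) (r : KMW (kappa (Some p)) 0) :
  f = g * val p ^+ m -> ~~ (val p %| g) ->
  kmw_val r = neps (kappa (Some p)) m * ang (qcls p g) ->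
  local_term (Some p) (tens (symK f%:F) (1 : Omega k)) = trace_ang r.
Proof.
move=> fE npg rE; rewrite /local_term /trace_ang.
have p0 : (val p)%:F != 0 :> kt by rewrite tofrac_eq0 pt_neq0.
have fc1 : form_coord (Some p) (1 : Omega k) = 1%:F.
  by rewrite /form_coord /= dfracX divr1 tofrac1.
have tw1 : twist_gen (Some p) (val p)%:F (1 : Omega k) = 1.
  rewrite /twist_gen fc1 divff // -tofrac1 red_affine qcls1.
  by rewrite invr1; exact: mulr1.
have [_ _ partE] := partialP (Some p).
have := partE (val p)%:F g%:F m [::] (1 : Omega k) 1 (symK f%:F) r.
rewrite tw1 => -> //.
- by rewrite /uniformizer_at p0 val_at_self eqxx.
- exact: unit_at_affine.
- by rewrite /generator_at fc1 unit_at_affine ?pt_ndvd1.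
- by rewrite big_nil mulr1 /= fE tofracM tofracXn.
- by rewrite big_nil mulr1 red_affine rE.
Qed.

Lemma neps_nat (K : fieldType) (m : nat) : neps K m = \sum_(i < m) (ang (- 1)) ^+ i.
Proof. by rewrite /= /eps opprK. Qed.

Lemma local_term_ndvd p f : ~~ (val p %| f) ->
  local_term (Some p) (tens (symK f%:F) (1 : Omega k)) = 0.
Proof.
move=> npf; rewrite (@local_term_affine p f f 0 0) ?trace_ang0 ?mulr1 //.
by rewrite neps_nat big_ord0 mul0r.
Qed.

Lemma local_term_simple p g : ~~ (val p %| g) ->
  local_term (Some p) (tens (symK (g * val p)%:F) (1 : Omega k)) = res_class (val p) g.
Proof.
move=> npg; rewrite (@local_term_affine p _ g 1 (angK (qcls p g))) //.
  exact: trace_ang_affine.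
by rewrite neps_nat big_ord1 expr0 mul1r.
Qed.

(** The residue is 2_eps = <1> + <-1>, and its transfers are Hankel classes with c = 1 and c = -1;
    in odd degree the two leftover lines make one more h. *)
Lemma local_term_sqr p :
  local_term (Some p) (tens (symK (val p * val p)%:F) (1 : Omega k)) =
  hyp_class k *+ (size (val p)).-1.
Proof.
have N10 : (- 1 : k) != 0 by rewrite oppr_eq0 oner_neq0.
have np : ~~ (val p %| (- 1)%:P) by rewrite polyCN dvdpNr pt_ndvd1.
rewrite (@local_term_affine p _ 1 2 (angK (qcls p 1) + angK (qcls p (- 1)%:P))).
- rewrite trace_angD !trace_ang_affine ?pt_ndvd1 //.
  have := res_classC (pt_neq0 p) (oner_neq0 k); rewrite polyC1 => ->.
  rewrite res_classC ?pt_neq0 // /hankel_class.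
  rewrite addrACA -mulrnDr; case: ifP => odd_d; last first.
    by rewrite !addr0; congr (_ *+ _); move/negbT: odd_d; lia.
  rewrite line_classN ?oner_neq0 // -mulrSr; congr (_ *+ _); move: odd_d; lia.
- by rewrite mul1r expr2.
- exact: pt_ndvd1.
- rewrite neps_nat !big_ord_recr big_ord0 /= add0r expr0 expr1.
  by rewrite qcls1 ang_one mulr1 qclsC scaleN1r.
Qed.

(** * The local term at infinity *)

Lemma ang_signX (K : fieldType) (c : K) i : c != 0 ->
  ang (- 1) ^+ i * ang c = ang ((- 1) ^+ i * c).
Proof.
move=> c0; elim: i => [|i ih]; first by rewrite !expr0 !mul1r.
by rewrite !exprS -!mulrA ih -ang_mul // ?oppr_eq0 ?oner_eq0 // mulf_neq0 ?signr_eq0.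
Qed.

(** (-n)_eps = eps n_eps with eps = - <-1>, which raises every exponent of <-1> by one. *)
Lemma neps_opp_nat (K : fieldType) (n : nat) :
  neps K (- n%:Z) = - \sum_(i < n) ang (- 1) ^+ i.+1.
Proof.
case: n => [|n]; first by rewrite oppr0 /= !big_ord0 oppr0.
rewrite -NegzE /= /eps mulNr opprK mulr_sumr; congr (- _).
by apply: eq_bigr => i _; rewrite exprS.
Qed.

(** (-n)_eps <c> = - n_eps <-c>, and [hankel_classS] builds up the right side line by line. An
    existential is used since the residue formula asks for a degree 0 element with a prescribed
    underlying ring element. *)
Lemma trace_ang_neps n (c : k) : c != 0 ->
  exists2 r : KMW (kappa None) 0,
    kmw_val r = neps (kappa None) (- n%:Z) * ang (c : kappa None) &
    trace_ang r = - hankel_class n (- c).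
Proof.
move=> c0; suff [r rE tr] : exists2 r : KMW (kappa None) 0,
    kmw_val r = (\sum_(i < n) ang (- 1) ^+ i.+1) * ang (c : kappa None) &
    trace_ang r = hankel_class n (- c).
  exists (0 - r); last by rewrite trace_angB trace_ang0 sub0r tr.
  by rewrite neps_opp_nat mulNr -rE sub0r.
elim: n => [|n [r rE tr]].
  by exists 0; rewrite ?trace_ang0 ?big_ord0 ?mul0r // /hankel_class addr0.
exists (r + angK ((- 1) ^+ n.+1 * (c : kappa None))).
  by rewrite big_ord_recr /= mulrDl ang_signX // -rE.
have c1 : (- 1) ^+ n.+1 * c != 0 by rewrite mulf_neq0 ?signr_eq0.
rewrite trace_angD tr (trace_ang_infty c1) hankel_classS ?oppr_eq0 //.
by rewrite exprSr mulrN1 mulrN mulNr.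
Qed.

(** The differential d(1/t) in the basis dt. *)
Definition omega_infty : Omega k := - (('X ^+ 2)%:F)^-1 : kt.

Lemma local_form_infty : local_form None = omega_infty.
Proof. exact: dfracV. Qed.

Lemma val_at_infty1 : val_at (None : closed_pt k) 1 = 0.
Proof. by rewrite -[1]divr1 -tofrac1 val_at_infty ?oner_neq0 // subrr. Qed.

Lemma red_infty1 : red (None : closed_pt k) 1 = 1.
Proof.
by rewrite -[X in red _ X]divr1 -tofrac1 red_infty ?oner_neq0 // divff //
  lead_coef_eq0 oner_neq0.
Qed.

(** For n = deg f, write f = (f / t^n) (1/t)^(-n): the first factor is a unit with residue class
    [lead_coef f], so the residue is (-n)_eps <lead_coef f>. *)
Lemma local_term_omega_infty f : f != 0 ->
  local_term None (tens (symK f%:F) omega_infty) =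
  - hankel_class (size f).-1 (- lead_coef f).
Proof.
move=> f0; pose n := (size f).-1.
have X0 : 'X != 0 :> {poly k} by rewrite polyX_eq0.
have XF0 : 'X%:F != 0 :> kt by rewrite tofrac_eq0.
have XV0 : ('X%:F)^-1 != 0 :> kt by rewrite invr_eq0.
have Xn0 : 'X^n != 0 :> {poly k} by rewrite expf_neq0.
have sXn : size f = size ('X^n : {poly k}).
  by rewrite size_polyXn prednK // size_poly_gt0.
have lc0 : lead_coef f != 0 by rewrite lead_coef_eq0.
have [r rE <-] := trace_ang_neps n lc0.
rewrite /local_term /trace_ang.
have om0 : omega_infty != 0 by rewrite oppr_eq0 invr_eq0 tofrac_eq0 expf_neq0.
have fc1 : form_coord None omega_infty = 1.
  by rewrite /form_coord local_form_infty divff.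
have tw1 : twist_gen None (('X%:F)^-1) omega_infty = 1.
  have pi1 : ('X%:F)^-1 / local_param None = 1 :> kt.
    exact: (divff XV0).
  rewrite /twist_gen pi1 fc1 red_infty1.
  by rewrite invr1; exact: mulr1.
have [_ _ partE] := partialP None.
have := partE ('X%:F)^-1 (f%:F / ('X^n)%:F) (- n%:Z) [::] omega_infty 1 (symK f%:F) r.
rewrite tw1 => -> //.
- rewrite /uniformizer_at invr_eq0 XF0 -[_^-1]mul1r -tofrac1 val_at_infty ?oner_neq0 //.
  by rewrite size_polyX size_poly1.
- rewrite /unit_at val_at_infty // sXn subrr eqxx andbT.
  by rewrite mulf_neq0 ?invr_eq0 ?tofrac_eq0.
- by rewrite /generator_at fc1 /unit_at val_at_infty1 eqxx oner_neq0.
- have XnF0 : ('X^n)%:F != 0 :> kt by rewrite tofrac_eq0.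
  by rewrite big_nil mulr1 exprz_inv opprK -exprnP -tofracXn divfK.
- rewrite big_nil mulr1 rE red_infty // lead_coefXn divr1 //.
Qed.

(** With u = - t^2, moving dt = u d(1/t) to the left factor replaces [f] by <u>[f] = [u f] - [u].
    The leading coefficient -1 of u removes the sign in the previous formula, and the h due to the
    two extra degrees of u f is cancelled by the term of [u]. *)
Lemma local_term_infty f : f != 0 ->
  local_term None (tens (symK f%:F) (1 : Omega k)) =
  - hankel_class (size f).-1 (lead_coef f).
Proof.
move=> f0; pose u : {poly k} := - 'X ^+ 2.
have u0 : u != 0 by rewrite oppr_eq0 expf_neq0 // polyX_eq0.
have uF0 : u%:F != 0 :> kt by rewrite tofrac_eq0.
have fF0 : f%:F != 0 :> kt by rewrite tofrac_eq0.
have omE : (1 : Omega k) = u%:F *: omega_infty.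
  rewrite /omega_infty /u tofracN scaleNr scalerN opprK.
  by apply/esym/divff; rewrite tofrac_eq0 expf_neq0 // polyX_eq0.
have -> : tens (symK f%:F) (1 : Omega k) = tens (angM u%:F (symK f%:F)) omega_infty.
  by rewrite omE (tens_ang _ _ uF0).
have -> : angM u%:F (symK f%:F) = symK (u * f)%:F - symK u%:F.
  have ufE : (u * f)%:F = u%:F * f%:F :> kt by exact: rmorphM.
  rewrite ufE.
  have E := angM_symK uF0 fF0.
  by rewrite E.
rewrite tensB local_termB !local_term_omega_infty ?mulf_neq0 //.
have lu : lead_coef u = - 1 by rewrite lead_coefN lead_coefXn.
have su : size u = 3 by rewrite size_polyN size_polyXn.
rewrite lead_coefM lu mulN1r !opprK.
have -> : size (u * f) = (size f).+2 by rewrite size_mul // su.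
have sf : (0 < size f)%N by rewrite size_poly_gt0.
rewrite su -{1}(prednK sf) /hankel_class /= negbK addr0 mulrS.
by rewrite mulr1n -addrA opprD addrAC addNr add0r.
Qed.

(** * Vanishing of the sum of local terms *)

Definition reciprocity s : Prop :=
  exists r : seq (closed_pt k), [/\ uniq r,
    forall x, x \notin r -> local_term x s = 0 &
    \sum_(x <- r) local_term x s = 0].

Lemma sum_local_term_widen (F : closed_pt k -> GW k^o) r t :
  uniq r -> uniq t -> {subset r <= t} -> (forall x, x \notin r -> F x = 0) ->
  \sum_(x <- t) F x = \sum_(x <- r) F x.
Proof.
move=> ur ut rt F0; rewrite (bigID (mem r)) /= [X in _ + X]big1 ?addr0; last first.
  by move=> x; exact: F0.
rewrite -big_filter; apply: perm_big; apply: uniq_perm; rewrite ?filter_uniq //.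
move=> x; rewrite mem_filter /=; case: (boolP (x \in r)) => //= xr; exact: rt.
Qed.

(** A witness list need only contain the support, so two lists can be enlarged to a common one;
    finiteness of the support is thereby proved along with the vanishing. *)
Lemma reciprocityB s t : reciprocity s -> reciprocity t -> reciprocity (s - t).
Proof.
move=> [r1 [u1 z1 e1]] [r2 [u2 z2 e2]].
exists (undup (r1 ++ r2)); split; first exact: undup_uniq.
  move=> x; rewrite mem_undup mem_cat negb_or => /andP[x1 x2].
  by rewrite local_termB z1 // z2 // subrr.
under eq_bigr do rewrite local_termB.
rewrite sumrB.
rewrite (@sum_local_term_widen (local_term ^~ s) r1) ?(undup_uniq, e1) //; last first.
  by move=> x xr; rewrite mem_undup mem_cat xr.
rewrite (@sum_local_term_widen (local_term ^~ t) r2) ?(undup_uniq, e2) ?subrr //.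
by move=> x xr; rewrite mem_undup mem_cat xr orbT.
Qed.

Lemma reciprocity0 : reciprocity 0.
Proof. by exists [::]; split=> [//|x _|]; rewrite ?big_nil ?local_term0. Qed.

Lemma reciprocityD s t : reciprocity s -> reciprocity t -> reciprocity (s + t).
Proof.
move=> hs ht; rewrite -[t]opprK -[- t]sub0r.
by apply: reciprocityB hs _; apply: reciprocityB reciprocity0 ht.
Qed.

Local Notation symt f := (tens (symK (f : kt)) (1 : Omega k)).

Lemma reciprocity_squarefree c (s : seq (affine_pt k)) : c != 0 -> uniq s ->
  reciprocity (symt (c%:P * \prod_(p <- s) val p)%:F).
Proof.
move=> c0 us; set P := \prod_(p <- s) val p.
have Pm : P \is monic by rewrite monic_prod // => p _; exact: pt_monic.
have P0 := monic_neq0 Pm.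
have cP0 : c%:P * P != 0 by rewrite mulf_neq0 // polyC_eq0.
have ndP p (t : seq (affine_pt k)) :
    (forall q, q \in t -> q != p) -> ~~ (val p %| c%:P * \prod_(q <- t) val q).
  move=> pt; rewrite mul_polyC dvdpZr //.
  elim: t pt => [|q t ih] pt; first by rewrite big_nil pt_ndvd1.
  rewrite big_cons Gauss_dvdpr; first by apply: ih => q' q't; apply: pt;
    rewrite inE q't orbT.
  apply: pt_coprime; have := pt q (mem_head _ _).
  by apply: contraNN => /pt_dvd_eq ->.
exists (None :: [seq Some p | p <- s]); split.
- rewrite /= map_inj_uniq ?us ?andbT; last by move=> p q [].
  by apply/mapP => -[].
- move=> [p|]; rewrite ?mem_head // inE /= mem_map; last by move=> ? ? [].
  move=> ps; apply: local_term_ndvd; apply: ndP => q qs.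
  by apply: contraNneq ps => <-.
rewrite big_cons big_map local_term_infty //.
(* The coefficient that the Chinese remainder decomposition puts at p, c times the product of the
   other factors, is the one in the residue of c P at p. *)
have -> : \sum_(p <- s) local_term (Some p) (symt (c%:P * P)%:F) = res_class P c%:P.
  rewrite res_class_prod //; first last.
  - move=> p _; apply: pt_coprime; have := ndP p [::].
    by rewrite big_nil mulr1; exact.
  - by move=> p q _ _ pq; apply: pt_coprime; apply: contraNN pq => /pt_dvd_eq ->.
  - by move=> p _; exact: pt_monic.
  rewrite [LHS]big_seq [RHS]big_seq; apply: eq_bigr => p ps.
  rewrite -local_term_simple; last first.
    by rewrite -big_filter; apply: ndP => q; rewrite mem_filter => /andP[].
  congr (local_term _ (tens (symK (_%:F)) _)).
  by rewrite /P (bigD1_seq p ps us) /=; ring.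
rewrite res_classC // lead_coefM lead_coefC (monicP Pm) mulr1.
have -> : size (c%:P * P) = size P by rewrite mul_polyC size_scale.
exact: addNr.
Qed.

(** The degree 2 deg p is even, so infinity contributes - (deg p) h, against (deg p) h at p. *)
Lemma reciprocity_sqr p : reciprocity (symt (val p * val p)%:F).
Proof.
exists [:: None; Some p]; split=> //.
  move=> [q|]; rewrite !inE // => qp.
  have ndqp : ~~ (val q %| val p).
    by apply: contraNN qp => /pt_dvd_eq ->; rewrite eqxx.
  apply: local_term_ndvd; rewrite Gauss_dvdpr //; exact: pt_coprime.
have p0 := pt_neq0 p; have sp : (0 < size (val p))%N by rewrite size_poly_gt0.
rewrite !big_cons big_nil addr0 local_term_sqr local_term_infty ?mulf_neq0 //.
rewrite lead_coefM (monicP (pt_monic p)) mulr1.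
have -> : (size (val p * val p)).-1 = (size (val p)).-1.*2.
  have -> : size (val p * val p) = (size (val p) + size (val p)).-1 by exact: size_mul.
  by rewrite -addnn; move: sp; case: (size _) => // m _; rewrite addSn addnS.
by rewrite /hankel_class doubleK odd_double addr0 addNr.
Qed.

Lemma symK_poly_mul_sqr g f : g != 0 -> f != 0 ->
  symK (g * (f * f))%:F = symK g%:F + symK (f * f)%:F :> KMW kt 1.
Proof.
move=> g0 f0; have gF0 : g%:F != 0 :> kt by rewrite tofrac_eq0.
have fF0 : f%:F != 0 :> kt by rewrite tofrac_eq0.
have -> : (g * (f * f))%:F = g%:F * (f * f)%:F :> kt by exact: rmorphM.
have -> : (f * f)%:F = f%:F * f%:F :> kt by exact: rmorphM.
by rewrite (symK_mul_sqr gF0 fF0).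
Qed.

Lemma reciprocity_poly f : f != 0 -> reciprocity (symt f%:F).
Proof.
elim: {f}(size f) {-2}f (leqnn (size f)) => [|n ih] f.
  by rewrite leqn0 size_poly_eq0 => ->.
move=> fn f0; have [[c [s [c0 us ->]]]|[p [g fE]]] := squarefree_or_sqr f0.
  exact: reciprocity_squarefree.
have p0 := pt_neq0 p; have [[sp _] _] := affine_ptP p.
have g0 : g != 0 by apply: contraNneq f0 => g0; rewrite fE g0 mul0r.
have -> : symt f%:F = symt g%:F + symt (val p * val p)%:F.
  rewrite -tensD fE; congr (tens _ _).
  exact: symK_poly_mul_sqr.
apply: reciprocityD (reciprocity_sqr p); apply: ih => //.
have sE : size f = (size g + (size (val p) + size (val p)).-1).-1.
  by rewrite fE size_mul ?mulf_neq0 // size_mul.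
move: fn sp; rewrite sE; move: (size g) (size (val p)) => a b; lia.
Qed.

(** For a = n / d the square d^2 clears the denominator: [n d] = [a d^2] = [a] + [d^2]. *)
Lemma reciprocity_sym (a : kt) : a != 0 -> reciprocity (symt a).
Proof.
move=> a0; pose n := \n_(repr a); pose d := \d_(repr a).
have d0 : d != 0 by exact: denom_ratioP.
have dF0 : d%:F != 0 :> kt by rewrite tofrac_eq0.
have ad : a * d%:F = n%:F by exact: frac_repr.
have n0 : n != 0 by rewrite -(tofrac_eq0 n) -ad mulf_neq0.
have -> : symt a = symt (n * d)%:F - symt (d * d)%:F.
  apply/esym/eqP; rewrite subr_eq -tensD; apply/eqP; congr (tens _ _).
  have -> : (n * d)%:F = a * (d%:F * d%:F) :> kt by rewrite mulrA ad; exact: rmorphM.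
  have -> : (d * d)%:F = d%:F * d%:F :> kt by exact: rmorphM.
  by rewrite (symK_mul_sqr a0 dF0).
by apply: reciprocityB; apply: reciprocity_poly; rewrite mulf_neq0.
Qed.

Lemma reciprocity_all s : reciprocity s.
Proof.
rewrite -(pcls_repr s); elim: (repr s) => {s} [[x l]||s hs|s hs t ht].
- suff : reciprocity (tens x l) by [].
  have [->|l0] := eqVneq l 0; first by rewrite tens0r; exact: reciprocity0.
  (* The element 1 of [Omega k] is dt, a basis, so the twist by l passes to the left factor as
     <l>. *)
  have lE : l = (l : kt) *: (1 : Omega k) by exact/esym/mulr1.
  have -> : tens x l = tens (angM (l : kt) x) (1 : Omega k).
    by rewrite {1}lE (tens_ang _ _ l0).
  elim/KMW1_ind: (angM _ x) => [|u v hu hv|a a0].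
  + by rewrite tens0l; exact: reciprocity0.
  + by rewrite tensB; exact: reciprocityB.
  + exact: reciprocity_sym.
- exact: reciprocity0.
- by have := reciprocityB reciprocity0 hs; rewrite sub0r [- _]poppE.
- by have := reciprocityD hs ht; rewrite [_ + _]paddE.
Qed.

End LocalTerms.

Local Open Scope classical_set_scope.

Theorem theorem4p3p7 (k : fieldType)
    (partial : forall (x : closed_pt k) (n : int),
       KMWt (Omega k) n -> KMWt (omega_pt x) (n - 1))
    (gw : forall x : closed_pt k, KMWt (omega_pt x) 0 -> GW (omega_pt x))
    (partialP : forall x, is_residue (partial x))
    (gwP : forall x, is_KMW0_to_GW (gw x))
    (sigma : KMWt (Omega k) 1) :
  let F (x : closed_pt k) := transfer_pt (gw x (partial x 1 sigma)) in
  finite_set [set x | F x != 0] /\ \sum_(x \in [set: closed_pt k]) F x = 0.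
Proof.
move=> F; have [r [ur r0 rs]] := reciprocity_all partialP gwP sigma.
split.
  apply: (sub_finite_set _ (finite_seq r)) => x /= /eqP; apply: contra_notT.
  exact: r0.
rewrite (fsbigE r) //; last by move=> x _; exact: r0.
by rewrite -[RHS]rs; apply: eq_bigl => x; rewrite in_setT.
Qed.
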